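(* Let $G$ be a countable monoid and let $X, Y$ be algebraic varieties over an uncountable algebraically closed field $k$. Let $\Sigma \subset X(k)^G$ be a closed algebraic subshift. Suppose that $\tau \colon \Sigma \to Y(k)^G$ is an injective algebraic cellular automaton. Then for every subshift $\Delta \subset X(k)^G$ contained in $\Sigma$: (i) $\Delta$ is a subshift of finite type of $X(k)^G$ if and only if $\tau(\Delta)$ is a subshift of finite type of $Y(k)^G$; (ii) $\Delta$ is a sofic subshift if and only if $\tau(\Delta)$ is a sofic subshift.
   Context: Let $G$ be a monoid with identity $1_G$ and $A$ a set. $G$ acts on $A^G$ by $(g\star x)(h)=x(hg)$ for $g,h\in G$, $x\in A^G$. A subshift of $A^G$ is a $G$-invariant subset $\Sigma\subset A^G$ (i.e. $g\star x\in\Sigma$ for all $g\in G$, $x\in\Sigma$); it is not required to be closed. $A^G$ carries the prodiscrete topology (product of discrete topologies), and ''closed'' refers to this topology. For $E\subset G$, $\Sigma_E=\{x|_E : x\in\Sigma\}\subset A^E$. For $D\subset G$ finite and $P\subset A^D$, put $\Sigma(A^G;D,P)=\{x\in A^G : (g\star x)|_D\in P \text{ for all } g\in G\}$, where elements of $A^D$ are maps $D \to A$; the subsets of $A^G$ of this form are the subshifts of finite type of $A^G$. For sets $A,B$ and a subshift $\Sigma\subset A^G$, a map $\tau\colon\Sigma\to B^G$ is a cellular automaton if there are a finite set $M\subset G$ (memory set) and a map $\mu\colon\Sigma_M\to B$ (local defining map) with $\tau(x)(g)=\mu((g\star x)|_M)$ for all $x\in\Sigma$, $g\in G$. A subshift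 is sofic if it is the image of a subshift of finite type (of $C^G$ for some alphabet set $C$) under a cellular automaton. An algebraic variety over $k$ is a reduced $k$-scheme of finite type; it is identified with its set of $k$-points. With $A=X(k)$, $B=Y(k)$: a subshift $\Sigma\subset A^G$ is an algebraic subshift if for every finite $E\subset G$ the restriction $\Sigma_E$ is a subvariety of $A^E$. For an algebraic subshift $\Sigma\subset A^G$, a map $\tau\colon\Sigma\to B^G$ is an algebraic cellular automaton if it is a cellular automaton admitting a finite memory set $M\subset G$ and an associated local defining map $\mu\colon\Sigma_M\to B$ that is a morphism of algebraic varieties over $k$. *)

(* Defs.v *)
From HB Require Import structures.
From mathcomp Require Export all_boot all_order all_algebra finmap.
From mathcomp Require Export boolp classical_sets functions cardinality.
From mathcomp Require Export topology.
(* Not imported: the notations of mpoly clash with those of mathcomp-analysis. *)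
From mathcomp Require mpoly.

Set Implicit Arguments.
Unset Strict Implicit.
Unset Printing Implicit Defensive.

Import GRing.Theory.
Local Open Scope classical_set_scope.
Local Open Scope ring_scope.

(* ------------------------------------------------------------------------ *)
(* Over an algebraically closed field k, sending a reduced k-scheme of      *)
(* finite type to its set of k-points, with the Zariski topology and the    *)
(* sheaf of k-valued regular functions, is an equivalence onto the spaces   *)
(* with functions having a finite open cover by closed algebraic subsets    *)
(* of affine spaces.  Neither separatedness nor irreducibility is required. *)
(* ------------------------------------------------------------------------ *)

(* A sheaf of k-algebras of k-valued functions.  A section over U is given  *)
(* by a total function of which only the restriction to U matters           *)
(* (regular_ext); regular U is meaningful only when U is open.              *)
Record fspace (k : fieldType) := FSpace {
  fpt :> topologicalType;
  regular : set fpt -> set (fpt -> k);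
  regular_ext : forall (U : set fpt) (f g : fpt -> k), open U ->
    (forall x, U x -> f x = g x) -> regular U f -> regular U g;
  regular_sub : forall (U V : set fpt) (f : fpt -> k), open U -> open V ->
    V `<=` U -> regular U f -> regular V f;
  regular_glue : forall (U : set fpt) (f : fpt -> k), open U ->
    (forall x, U x -> exists V, [/\ open V, V x, V `<=` U & regular V f]) ->
    regular U f;
  regular_cst : forall (U : set fpt) (c : k), open U -> regular U (fun=> c);
  regular_add : forall (U : set fpt) (f g : fpt -> k), open U ->
    regular U f -> regular U g -> regular U (fun x => f x + g x);
  regular_mul : forall (U : set fpt) (f g : fpt -> k), open U ->
    regular U f -> regular U g -> regular U (fun x => f x * g x);
  regular_inv : forall (U : set fpt) (f : fpt -> k), open U -> regular U f ->
    open (U `&` [set x | f x != 0]) /\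
    regular (U `&` [set x | f x != 0]) (fun x => (f x)^-1) }.
Arguments regular {k} _ _ _.

Definition morphism (k : fieldType) (S T : fspace k) (f : S -> T) : Prop :=
  continuous f /\
  forall (V : set T) (g : T -> k), open V -> regular T V g ->
    regular S (f @^-1` V) (g \o f).

Definition isomorphic (k : fieldType) (S T : fspace k) : Prop :=
  exists (f : S -> T) (g : T -> S),
    [/\ cancel f g, cancel g f, morphism f & morphism g].

Section Subspace.
Variables (k : fieldType) (S : fspace k) (Z : set S).

Definition sub_regular (W : set Z) (f : Z -> k) : Prop :=
  forall x : Z, W x -> exists (U : set S) (g : S -> k),
    [/\ open U, U (set_val x), regular S U g &
        forall y : Z, W y -> U (set_val y) -> f y = g (set_val y)].

Lemma sub_regular_ext (W : set Z) (f g : Z -> k) : open W ->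
  (forall x, W x -> f x = g x) -> sub_regular W f -> sub_regular W g.
Proof.
move=> _ fg rf x Wx; have [U [h [oU Ux rh fh]]] := rf x Wx.
by exists U, h; split=> // y Wy Uy; rewrite -fg // fh.
Qed.

Lemma sub_regular_sub (W V : set Z) (f : Z -> k) : open W -> open V ->
  V `<=` W -> sub_regular W f -> sub_regular V f.
Proof.
move=> _ _ VW rf x Vx; have [U [h [oU Ux rh fh]]] := rf x (VW _ Vx).
by exists U, h; split=> // y Vy Uy; rewrite fh//; exact: VW.
Qed.

Lemma sub_regular_glue (W : set Z) (f : Z -> k) : open W ->
  (forall x, W x -> exists V, [/\ open V, V x, V `<=` W & sub_regular V f]) ->
  sub_regular W f.
Proof.
move=> _ H x /H[V [[V' oV' <-] Vx _ /(_ x Vx)[U [h [oU Ux rh fh]]]]].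
exists (U `&` V'), h; split=> //.
- exact: openI.
- by apply: (regular_sub oU _ _ rh); [exact: openI|move=> y []].
- by move=> y Wy [Uy Vy]; exact: fh.
Qed.

Lemma sub_regular_cst (W : set Z) (c : k) : open W -> sub_regular W (fun=> c).
Proof.
by move=> _ x Wx; exists setT, (fun=> c); split=> //;
  [exact: openT|apply: regular_cst; exact: openT].
Qed.

Lemma sub_regular_op (op : k -> k -> k) :
  (forall (U : set S) (f g : S -> k), open U -> regular S U f ->
     regular S U g -> regular S U (fun x => op (f x) (g x))) ->
  forall (W : set Z) (f g : Z -> k), open W -> sub_regular W f ->
    sub_regular W g -> sub_regular W (fun x => op (f x) (g x)).
Proof.
move=> Hop W f g _ rf rg x Wx.
have [U [h [oU Ux rh fh]]] := rf x Wx; have [U' [h' [oU' Ux' rh' fh']]] := rg x Wx.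
have oI : open (U `&` U') by exact: openI.
exists (U `&` U'), (fun y => op (h y) (h' y)); split=> //.
- by apply: Hop => //; [apply: (regular_sub oU _ _ rh)|
    apply: (regular_sub oU' _ _ rh')] => // y [].
- by move=> y Wy [Uy Uy']; rewrite fh ?fh'.
Qed.

Lemma sub_regular_inv (W : set Z) (f : Z -> k) : open W -> sub_regular W f ->
  open (W `&` [set x | f x != 0]) /\
  sub_regular (W `&` [set x | f x != 0]) (fun x => (f x)^-1).
Proof.
move=> oW rf; split; last first.
  move=> x [Wx fx]; have [U [h [oU Ux rh fh]]] := rf x Wx.
  have [oD rD] := regular_inv oU rh.
  exists (U `&` [set y | h y != 0]), (fun y => (h y)^-1); split=> //.
    by split=> //=; rewrite -fh.
  by move=> y [Wy _] [Uy _]; rewrite fh.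
rewrite openE => x [Wx fx]; have [U [h [oU Ux rh fh]]] := rf x Wx.
have [oD _] := regular_inv oU rh.
apply: (@filterS _ _ _ (W `&` set_val @^-1` (U `&` [set y | h y != 0]))).
  by move=> y [Wy [Uy hy]]; split=> //=; rewrite fh.
apply: open_nbhs_nbhs; split; last by split=> //; split=> //=; rewrite -fh.
by apply: openI => //; exists (U `&` [set y | h y != 0]).
Qed.

Definition sub_fspace : fspace k :=
  FSpace sub_regular_ext sub_regular_sub sub_regular_glue sub_regular_cst
    (sub_regular_op (@regular_add k S)) (sub_regular_op (@regular_mul k S))
    sub_regular_inv.

End Subspace.

(* fb_fun U f: f is one of the generating functions on the subset U. *)
Record fraction_base (k : fieldType) (T : choiceType) := FractionBase {
  fb_fun : set T -> set (T -> k);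
  fb_cst : forall p, exists2 U, U p & forall c, fb_fun U (fun=> c);
  fb_add : forall U V f g, fb_fun U f -> fb_fun V g ->
    fb_fun (U `&` V) (fun x => f x + g x);
  fb_mul : forall U V f g, fb_fun U f -> fb_fun V g ->
    fb_fun (U `&` V) (fun x => f x * g x) }.

Definition fb_type k T (B : @fraction_base k T) : Type := T.

(* The space with functions generated by a fraction base: basic open sets   *)
(* are the nonvanishing loci of generating functions, and the regular       *)
(* functions are locally quotients of generating functions.                 *)
Section FractionSpace.
Variables (k : fieldType) (T : choiceType) (B : fraction_base k T).
Local Notation TB := (fb_type B).

Definition fb_open (W : set TB) : Prop :=
  forall p, W p -> exists (U : set T) (b : T -> k),
    [/\ U p, fb_fun B U b, b p != 0 & U `&` [set q | b q != 0] `<=` W].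

Definition fb_regular (W : set TB) (f : TB -> k) : Prop :=
  forall p, W p -> exists (U : set T) (a b : T -> k),
    [/\ U p, fb_fun B U a, fb_fun B U b, b p != 0 &
        forall q, W q -> U q -> b q != 0 -> f q = a q / b q].

Lemma fb_openT : fb_open setT.
Proof.
move=> p _; have [U Up Uc] := fb_cst B p.
by exists U, (fun=> 1); split=> //; exact: oner_neq0.
Qed.

Lemma fb_openI : setI_closed fb_open.
Proof.
move=> V W oV oW p [/oV[U [b [Up Ub bp bV]]] /oW[U' [b' [Up' Ub' bp' bW]]]].
exists (U `&` U'), (fun x => b x * b' x); split=> //.
- exact: fb_mul.
- by rewrite mulf_neq0.
- move=> q [[Uq Uq']] /=; rewrite mulf_eq0 negb_or => /andP[bq bq'].
  by split; [exact: bV|exact: bW].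
Qed.

Lemma fb_open_bigU (I : Type) (F : I -> set TB) :
  (forall i, fb_open (F i)) -> fb_open (\bigcup_i F i).
Proof.
move=> oF p [i _ /(oF i)[U [b [Up Ub bp bF]]]].
by exists U, b; split=> // q /bF; exists i.
Qed.

HB.instance Definition _ := Choice.copy TB T.
HB.instance Definition _ :=
  isOpenTopological.Build TB fb_openT fb_openI fb_open_bigU.

Lemma fb_regular_ext (U : set TB) (f g : TB -> k) : open U ->
  (forall x, U x -> f x = g x) -> fb_regular U f -> fb_regular U g.
Proof.
move=> _ fg rf p Up; have [V [a [b [Vp Va Vb bp fab]]]] := rf p Up.
by exists V, a, b; split=> // q Uq Vq bq; rewrite -fg// fab.
Qed.

Lemma fb_regular_sub (U V : set TB) (f : TB -> k) : open U -> open V ->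
  V `<=` U -> fb_regular U f -> fb_regular V f.
Proof.
move=> _ _ VU rf p Vp; have [W [a [b [Wp Wa Wb bp fab]]]] := rf p (VU _ Vp).
by exists W, a, b; split=> // q Vq Wq bq; rewrite fab//; exact: VU.
Qed.

Lemma fb_regular_glue (U : set TB) (f : TB -> k) : open U ->
  (forall x, U x -> exists V, [/\ open V, V x, V `<=` U & fb_regular V f]) ->
  fb_regular U f.
Proof.
move=> _ H p /H[V [oV Vp _ /(_ p Vp)[W [a [b [Wp Wa Wb bp fab]]]]]].
have [W' [c [Wp' Wc cp cV]]] := oV p Vp.
exists (W `&` W'), (fun x => a x * c x), (fun x => b x * c x); split=> //.
- exact: fb_mul.
- exact: fb_mul.
- by rewrite mulf_neq0.
- move=> q _ [Wq Wq']; rewrite mulf_eq0 negb_or => /andP[bq cq].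
  by rewrite -mulf_div divff// mulr1; apply: fab => //; apply: cV.
Qed.

Lemma fb_regular_cst (U : set TB) (c : k) : open U -> fb_regular U (fun=> c).
Proof.
move=> _ p _; have [V Vp Vc] := fb_cst B p.
by exists V, (fun=> c), (fun=> 1); split=> //;
  [exact: oner_neq0|move=> *; rewrite divr1].
Qed.

Lemma fb_regular_add (U : set TB) (f g : TB -> k) : open U ->
  fb_regular U f -> fb_regular U g -> fb_regular U (fun x => f x + g x).
Proof.
move=> _ rf rg p Up; have [V [a [b [Vp Va Vb bp fab]]]] := rf p Up.
have [V' [a' [b' [Vp' Va' Vb' bp' gab]]]] := rg p Up.
exists (V `&` V'), (fun x => a x * b' x + b x * a' x), (fun x => b x * b' x).
split=> //.
- by rewrite -[V `&` V']setIid; apply: fb_add; exact: fb_mul.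
- exact: fb_mul.
- by rewrite mulf_neq0.
- move=> q Uq [Vq Vq']; rewrite mulf_eq0 negb_or => /andP[bq bq'].
  by rewrite fab// gab// addf_div// [a' q * _]mulrC.
Qed.

Lemma fb_regular_mul (U : set TB) (f g : TB -> k) : open U ->
  fb_regular U f -> fb_regular U g -> fb_regular U (fun x => f x * g x).
Proof.
move=> _ rf rg p Up; have [V [a [b [Vp Va Vb bp fab]]]] := rf p Up.
have [V' [a' [b' [Vp' Va' Vb' bp' gab]]]] := rg p Up.
exists (V `&` V'), (fun x => a x * a' x), (fun x => b x * b' x).
split=> //.
- exact: fb_mul.
- exact: fb_mul.
- by rewrite mulf_neq0.
- move=> q Uq [Vq Vq']; rewrite mulf_eq0 negb_or => /andP[bq bq'].
  by rewrite fab// gab// mulf_div.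
Qed.

Lemma fb_regular_inv (U : set TB) (f : TB -> k) : open U -> fb_regular U f ->
  open (U `&` [set x | f x != 0]) /\
  fb_regular (U `&` [set x | f x != 0]) (fun x => (f x)^-1).
Proof.
move=> oU rf; split.
  suff : fb_open (U `&` [set x | f x != 0]) by [].
  move=> p [Up fp]; have [V [a [b [Vp Va Vb bp fab]]]] := rf p Up.
  have ap : a p != 0.
    by apply: contraNneq fp => ap /=; rewrite fab// ap mul0r.
  have [W [c [Wp Wc cp cU]]] := oU p Up.
  exists ((V `&` V) `&` W), (fun x => (a x * b x) * c x); split=> //.
  - by apply: fb_mul => //; exact: fb_mul.
  - by rewrite !mulf_neq0.
  - move=> q [[[Vq _] Wq]] /=; rewrite !mulf_eq0 !negb_or => /andP[/andP[aq bq] cq].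
    have Uq : U q by exact: cU.
    by split=> //=; rewrite fab// mulf_neq0// invr_neq0.
move=> p [Up fp]; have [V [a [b [Vp Va Vb bp fab]]]] := rf p Up.
have ap : a p != 0.
  by apply: contraNneq fp => ap /=; rewrite fab// ap mul0r.
exists (V `&` V), (fun x => b x * b x), (fun x => a x * b x); split=> //.
- exact: fb_mul.
- exact: fb_mul.
- by rewrite mulf_neq0.
- move=> q [Uq _] [Vq _]; rewrite mulf_eq0 negb_or => /andP[aq bq].
  by rewrite fab// invf_div -mulf_div divff// mulr1.
Qed.

Definition fraction_fspace : fspace k :=
  @FSpace k TB fb_regular fb_regular_ext fb_regular_sub fb_regular_glue
    fb_regular_cst fb_regular_add fb_regular_mul fb_regular_inv.

End FractionSpace.

Section AffineSpace.
Variables (k : fieldType) (n : nat).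

Definition poly_fun (U : set ('I_n -> k)) (f : ('I_n -> k) -> k) : Prop :=
  U = setT /\ exists P : mpoly.mpoly n k, f = fun v => mpoly.meval v P.

Lemma poly_fun_cst p : exists2 U, U p & forall c, poly_fun U (fun=> c).
Proof.
exists setT => // c; split=> //; exists (mpoly.mpolyC n c).
by apply/funext => v; rewrite mpoly.mevalC.
Qed.

Lemma poly_fun_add U V f g : poly_fun U f -> poly_fun V g ->
  poly_fun (U `&` V) (fun x => f x + g x).
Proof.
move=> [-> [P ->]] [-> [Q ->]]; split; first by rewrite setIT.
by eexists; apply/funext => v; rewrite -mpoly.mevalD.
Qed.

Lemma poly_fun_mul U V f g : poly_fun U f -> poly_fun V g ->
  poly_fun (U `&` V) (fun x => f x * g x).
Proof.
move=> [-> [P ->]] [-> [Q ->]]; split; first by rewrite setIT.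
by eexists; apply/funext => v; rewrite -mpoly.mevalM.
Qed.

Definition affine_space : fspace k :=
  fraction_fspace (FractionBase poly_fun_cst poly_fun_add poly_fun_mul).

End AffineSpace.

(* The product of copies of X indexed by a finite type I.  Over a box       *)
(* \prod_i U i of open sets, the generating functions are the image of      *)
(* \bigotimes_i O(U i); the scalars c j are needed when I is empty.  The    *)
(* topology is finer than the product topology.                             *)
Section Product.
Variables (k : fieldType) (I : finType) (X : fspace k).

Definition tensor_fun (W : set (I -> X)) (f : (I -> X) -> k) : Prop :=
  exists U : I -> set X,
    [/\ forall i, open (U i), W = [set q | forall i, U i (q i)] &
        exists (J : finType) (c : J -> k) (h : J -> I -> X -> k),
          (forall j i, regular X (U i) (h j i)) /\
          f = fun q => \sum_j c j * \prod_i h j i (q i)].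

Lemma tensor_fun_cst p : exists2 W, W p & forall c, tensor_fun W (fun=> c).
Proof.
exists setT => // c; exists (fun=> setT); split; first by move=> _; exact: openT.
  by apply/seteqP; split.
exists unit, (fun=> c), (fun _ _ _ => 1); split.
  by move=> _ i; apply: regular_cst; exact: openT.
by apply/funext => q; rewrite big_const cardE enumT unlock /= addr0 big1 ?mulr1.
Qed.

Lemma box_setI (U V : I -> set X) :
  [set q : I -> X | forall i, U i (q i)] `&` [set q | forall i, V i (q i)] =
  [set q | forall i, (U i `&` V i) (q i)].
Proof.
by apply/seteqP; split=> q /=; [move=> [Uq Vq] i|
  move=> UVq; split=> i; have [] := UVq i].
Qed.

Lemma tensor_fun_add W W' f g : tensor_fun W f -> tensor_fun W' g ->
  tensor_fun (W `&` W') (fun x => f x + g x).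
Proof.
move=> [U [oU -> [J [c [h [rh ->]]]]]] [U' [oU' -> [J' [c' [h' [rh' ->]]]]]].
have oI i : open (U i `&` U' i) by exact: openI.
exists (fun i => U i `&` U' i); split=> //; first exact: box_setI.
exists (J + J')%type, (fun s => match s with inl j => c j | inr j => c' j end),
  (fun s => match s with inl j => h j | inr j => h' j end); split.
  by move=> [j|j] i; [apply: (regular_sub (oU i) _ _ (rh j i))|
    apply: (regular_sub (oU' i) _ _ (rh' j i))] => // y [].
by apply/funext => q; rewrite big_sumType.
Qed.

Lemma tensor_fun_mul W W' f g : tensor_fun W f -> tensor_fun W' g ->
  tensor_fun (W `&` W') (fun x => f x * g x).
Proof.
move=> [U [oU -> [J [c [h [rh ->]]]]]] [U' [oU' -> [J' [c' [h' [rh' ->]]]]]].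
have oI i : open (U i `&` U' i) by exact: openI.
exists (fun i => U i `&` U' i); split=> //; first exact: box_setI.
exists (J * J')%type, (fun s => c s.1 * c' s.2),
  (fun s i x => h s.1 i x * h' s.2 i x); split.
  move=> [j j'] i /=; apply: regular_mul => //;
    [apply: (regular_sub (oU i) _ _ (rh j i))|
     apply: (regular_sub (oU' i) _ _ (rh' j' i))] => // y [] //.
apply/funext => q; rewrite big_distrlr pair_big /=; apply: eq_bigr => s _.
by rewrite mulrACA big_split.
Qed.

Definition prod_fspace : fspace k :=
  fraction_fspace (FractionBase tensor_fun_cst tensor_fun_add tensor_fun_mul).

End Product.

Definition is_affine (k : fieldType) (S : fspace k) : Prop :=
  exists (n : nat) (Z : set (affine_space k n)),
    closed Z /\ isomorphic S (sub_fspace Z).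

Record variety (k : closedFieldType) := Variety {
  var_fspace :> fspace k;
  var_cover : exists (m : nat) (U : 'I_m -> set var_fspace),
    [/\ forall i, open (U i), \bigcup_i U i = setT &
        forall i, is_affine (sub_fspace (U i))] }.

(* Subvarieties are the locally closed subsets, with the induced reduced    *)
(* structure sub_fspace.                                                    *)
Definition is_subvariety (k : fieldType) (S : fspace k) (Z : set S) : Prop :=
  exists U C : set S, [/\ open U, closed C & Z = U `&` C].

Section Shifts.
Variable G : monoidType.

Definition shift (A : Type) (g : G) (x : G -> A) : G -> A :=
  fun h => x (h * g)%g.

Definition restr (A : Type) (E : {fset G}) (x : G -> A) : E -> A :=
  fun e => x (fsval e).
Arguments restr {A} E x.

Definition is_subshift (A : Type) (Sigma : set (G -> A)) : Prop :=
  forall g x, Sigma x -> Sigma (shift g x).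

Definition closed_prodiscrete (A : choiceType) (Sigma : set (G -> A)) : Prop :=
  closed (Sigma : set {ptws G -> discrete_topology A}).

Definition sft (A : Type) (D : {fset G}) (P : set (D -> A)) : set (G -> A) :=
  [set x | forall g, P (restr D (shift g x))].

Definition is_sft (A : Type) (Sigma : set (G -> A)) : Prop :=
  exists (D : {fset G}) (P : set (D -> A)), Sigma = sft P.

(* When Sigma is a subshift, the pattern u exists and is unique. *)
Definition local_defining_map (A B : Type) (Sigma : set (G -> A))
    (tau : Sigma -> (G -> B)) (M : {fset G}) (mu : restr M @` Sigma -> B) : Prop :=
  forall (x : Sigma) (g : G), exists2 u : restr M @` Sigma,
    set_val u = restr M (shift g (set_val x)) & tau x g = mu u.

Definition is_cellular_automaton (A B : Type) (Sigma : set (G -> A))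
    (tau : Sigma -> (G -> B)) : Prop :=
  exists (M : {fset G}) (mu : restr M @` Sigma -> B), local_defining_map tau mu.

Definition is_sofic (A : Type) (Delta : set (G -> A)) : Prop :=
  exists (C : Type) (Gamma : set (G -> C)) (sigma : Gamma -> (G -> A)),
    [/\ is_sft Gamma, is_cellular_automaton sigma & Delta = range sigma].

(* The image of Delta under a map defined on Sigma; used for Delta `<=` Sigma. *)
Definition image_in (A B : Type) (Sigma : set (G -> A))
    (tau : Sigma -> (G -> B)) (Delta : set (G -> A)) : set (G -> B) :=
  tau @` (set_val @^-1` Delta).

Section Algebraic.
Variables (k : closedFieldType) (X Y : variety k).

Definition is_algebraic_subshift (Sigma : set (G -> X)) : Prop :=
  is_subshift Sigma /\
  forall E : {fset G},
    @is_subvariety k (prod_fspace E X) (restr E @` Sigma).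

Definition is_algebraic_ca (Sigma : set (G -> X)) (tau : Sigma -> (G -> Y)) : Prop :=
  exists (M : {fset G}) (mu : restr M @` Sigma -> Y),
    local_defining_map tau mu /\
    @morphism k (@sub_fspace k (prod_fspace M X) (restr M @` Sigma)) Y mu.

End Algebraic.
End Shifts.

(* Main.v *)
Require Import Defs.
From mathcomp Require Import closed_field.

(** An injective algebraic cellular automaton is a conjugacy onto its image:
    its inverse is again given by a finite window.  Once this is known, both
    equivalences are the formal fact that being of finite type, or sofic, is
    preserved by a bijection which is a sliding block map in both directions
    ([sft_preimage], [sofic_image]).

    The finite window ([tau_window]) comes from a compactness argument.  Suppose
    that no finite N is such that tau x and tau y agreeing on N forces
    x 1 = y 1.  Then every finite part of the following countable list of
    conditions on a pair (x, y) can be met: the restrictions of x and y to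
    finite sets lie in those of Sigma, x 1 differs from y 1, and tau x and
    tau y agree at g (one condition for each g).  If all of them could be met at
    once, closedness of Sigma would give x and y in Sigma, and they would
    contradict injectivity.

    To pass from finite parts to the whole list, points are coded by tuples of
    elements of k so that each condition becomes constructible, that is, a
    boolean combination of polynomial equations in finitely many of countably
    many variables.  A countable list of constructible conditions over an
    uncountable algebraically closed field can be met as soon as its finite
    parts can ([constructible_saturated]): choose the variables one at a time.
    By quantifier elimination, the admissible values of the next variable form
    a decreasing sequence of nonempty sets, each finite or cofinite, and such
    sequences have a common point because k is uncountable.

    Constructibility of the conditions rests on two facts.  By definition, open
    sets and regular functions are, near each point, described by fractions of
    polynomials in the coordinates of a chart; by Hilbert's basis theorem
    ([polyfun_noetherian]) finitely many of these descriptions suffice, so the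
    graph of a regular function is constructible ([chart_graph]).  And charts
    pass to finite products and to locally closed subsets, which are the only
    constructions through which Sigma_E and the local defining map are
    built. *)

Set Implicit Arguments.
Unset Strict Implicit.
Unset Printing Implicit Defensive.
Import GRing.Theory.
Local Open Scope classical_set_scope.
Local Open Scope ring_scope.

(** * Polynomial functions and constructible sets *)

Section Constructible.
Variable k : fieldType.

(** Polynomials are handled through their values, so that the variables may be
    indexed by an arbitrary type. *)
Inductive polyfun (V : Type) : ((V -> k) -> k) -> Prop :=
| polyfun_cst c : polyfun (fun=> c)
| polyfun_var v : polyfun (fun a => a v)
| polyfun_add f g : polyfun f -> polyfun g -> polyfun (fun a => f a + g a)
| polyfun_mul f g : polyfun f -> polyfun g -> polyfun (fun a => f a * g a).

Lemma polyfun_subst (V W : Type) (h : W -> (V -> k) -> k) f :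
  (forall w, polyfun (h w)) -> polyfun f -> polyfun (fun a => f (fun w => h w a)).
Proof.
move=> ph; elim=> [c|v|g g' _ Pg _ Pg'|g g' _ Pg _ Pg'].
- exact: polyfun_cst.
- exact: ph.
- exact: polyfun_add.
- exact: polyfun_mul.
Qed.

Lemma polyfun_sub (V : Type) (f g : (V -> k) -> k) :
  polyfun f -> polyfun g -> polyfun (fun a => f a - g a).
Proof.
move=> pf pg; rewrite (_ : (fun a => _) = fun a => f a + (-1) * g a).
  by apply: polyfun_add => //; apply: polyfun_mul => //; exact: polyfun_cst.
by apply/funext => a; rewrite mulN1r.
Qed.

Inductive constructible (V : Type) : set (V -> k) -> Prop :=
| constructible_zero f : polyfun f -> constructible [set a | f a = 0]
| constructibleI C D : constructible C -> constructible D -> constructible (C `&` D)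
| constructibleC D : constructible D -> constructible (~` D).

Lemma constructible_ext (V : Type) (C D : set (V -> k)) :
  (forall a, C a <-> D a) -> constructible C -> constructible D.
Proof. by move=> CD; rewrite (_ : D = C) //; apply/seteqP; split=> a /CD. Qed.

Lemma constructibleU (V : Type) (C D : set (V -> k)) :
  constructible C -> constructible D -> constructible (C `|` D).
Proof.
move=> cC cD; rewrite -[_ `|` _]setCK setCU.
by apply: constructibleC; apply: constructibleI; apply: constructibleC.
Qed.

Lemma constructible_cst (V : Type) (P : Prop) : constructible [set _ : V -> k | P].
Proof.
have c0 (c : k) : constructible [set _ : V -> k | c = 0].
  by apply: (constructible_zero (f := fun=> c)); exact: polyfun_cst.
have [p|np] := pselect P.
  by apply: constructible_ext (c0 0) => a /=.
by apply: constructible_ext (c0 1) => a /=; split=> // /eqP; rewrite oner_eq0.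
Qed.

Lemma constructible_eq (V : Type) (f g : (V -> k) -> k) :
  polyfun f -> polyfun g -> constructible [set a | f a = g a].
Proof.
move=> pf pg; apply: constructible_ext (constructible_zero (polyfun_sub pf pg)) => a /=.
by split=> [/eqP|->]; [rewrite subr_eq0 => /eqP|rewrite subrr].
Qed.

Lemma constructible_neq0 (V : Type) (f : (V -> k) -> k) :
  polyfun f -> constructible [set a | f a != 0].
Proof.
by move=> pf; apply: constructible_ext (constructibleC (constructible_zero pf)) => a /=;
  split=> [/eqP|/eqP].
Qed.

Lemma constructible_bigU (V : Type) (I : eqType) (s : seq I) (C : I -> set (V -> k)) :
  (forall i, constructible (C i)) -> constructible [set a | exists2 i, i \in s & C i a].
Proof.
move=> cC; elim: s => [|i s IHs].
  by apply: constructible_ext (constructible_cst V False) => a /=; split=> // -[].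
apply: constructible_ext (constructibleU (cC i) IHs) => a /=; split.
  move=> [Cia|[j js Cja]]; first by exists i => //; rewrite mem_head.
  by exists j => //; rewrite in_cons js orbT.
by move=> [j]; rewrite in_cons => /orP[/eqP->|js Cja]; [left|right; exists j].
Qed.

Lemma constructible_exists (V : Type) (I : finType) (C : I -> set (V -> k)) :
  (forall i, constructible (C i)) -> constructible [set a | exists i, C i a].
Proof.
move=> /(constructible_bigU (index_enum I)); apply: constructible_ext => a /=.
by split=> [[i _ Ci]|[i Ci]]; exists i => //; exact: mem_index_enum.
Qed.

Lemma constructible_forall (V : Type) (I : finType) (C : I -> set (V -> k)) :
  (forall i, constructible (C i)) -> constructible [set a | forall i, C i a].
Proof.
move=> cC; have := constructibleC (constructible_exists (fun i => constructibleC (cC i))).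
apply: constructible_ext => a /=; split=> [nC i|C_ [i]]; last exact.
by apply: contrapT => nCi; apply: nC; exists i.
Qed.

Lemma constructible_subst (V W : Type) (h : W -> (V -> k) -> k) C :
  (forall w, polyfun (h w)) -> constructible C ->
  constructible [set a | C (fun w => h w a)].
Proof.
move=> ph; elim=> [f pf|D E _ cD _ cE|D _ cD].
- exact: (constructible_zero (polyfun_subst ph pf)).
- exact: (constructibleI cD cE).
- exact: (constructibleC cD).
Qed.

Lemma constructible_reindex (V W : Type) (s : W -> V) C :
  constructible C -> constructible [set a : V -> k | C (fun w => a (s w))].
Proof. by apply: constructible_subst => w; exact: polyfun_var. Qed.

End Constructible.

(** * Elimination of a variable *)

Section Projection.
Variable k : closedFieldType.

Definition upd (a : nat -> k) (i : nat) (c : k) : nat -> k :=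
  fun j => if j == i then c else a j.

(** [polyfun_term], [constructible_formula] and their converses translate between sets
    and first-order syntax.  An assignment is cut down to a long enough list,
    and the bound N absorbs the default value 0 of variables off the list. *)
Lemma polyfun_term (f : (nat -> k) -> k) : polyfun f ->
  exists (t : GRing.term k) (N : nat), GRing.rterm t /\
    forall n a, (N <= n)%N -> GRing.eval (mkseq a n) t = f a.
Proof.
elim=> [c|v|g g' _ [t [N [rt tg]]] _ [t' [N' [rt' tg']]]
           |g g' _ [t [N [rt tg]]] _ [t' [N' [rt' tg']]]].
- by exists (GRing.Const c), 0%N.
- by exists (GRing.Var k v), v.+1; split=> // n a vn /=; rewrite nth_mkseq.
- exists (GRing.Add t t'), (maxn N N'); split=> /= [|n a]; first by rewrite rt.
  by rewrite geq_max => /andP[Nn N'n]; rewrite tg ?tg'.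
- exists (GRing.Mul t t'), (maxn N N'); split=> /= [|n a]; first by rewrite rt.
  by rewrite geq_max => /andP[Nn N'n]; rewrite tg ?tg'.
Qed.

Lemma constructible_formula (D : set (nat -> k)) : constructible D ->
  exists (f : GRing.formula k) (N : nat), GRing.qf_form f && GRing.rformula f /\
    forall n a, (N <= n)%N -> GRing.qf_eval (mkseq a n) f <-> D a.
Proof.
elim=> [f /polyfun_term[t [N [rt tf]]]
  |C E _ [f [N [/andP[qf rf] fC]]] _ [f' [N' [/andP[qf' rf'] fE]]]
  |C _ [f [N [wf fC]]]].
- exists (GRing.Equal t (GRing.Const 0)), N; split=> /= [|n a Nn].
    by rewrite rt.
  by rewrite tf //; split=> /eqP.
- exists (GRing.And f f'), (maxn N N'); split=> /= [|n a].
    by rewrite qf qf' rf.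
  rewrite geq_max => /andP[Nn N'n]; split.
    by move=> /andP[/(fC n a Nn)Ca /(fE n a N'n)Ea].
  by move=> [Ca Ea]; apply/andP; split; [exact/(fC n a Nn)|exact/(fE n a N'n)].
- exists (GRing.Not f), N; split=> //= n a Nn.
  by split=> [/negP nf /(fC n a Nn)//|nC]; apply/negP => /(fC n a Nn).
Qed.

Lemma term_polyfun n (t : GRing.term k) : GRing.rterm t ->
  polyfun (fun a : nat -> k => GRing.eval (mkseq a n) t).
Proof.
elim: t => //=.
- move=> v _; have [vn|nv] := ltnP v n.
    rewrite (_ : (fun a => _) = fun a => a v); first exact: polyfun_var.
    by apply/funext => a; rewrite nth_mkseq.
  rewrite (_ : (fun a => _) = fun=> 0); first exact: polyfun_cst.
  by apply/funext => a; rewrite nth_default// size_mkseq.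
- by move=> c _; exact: polyfun_cst.
- by move=> m _; exact: polyfun_cst.
- by move=> t IHt u IHu /andP[/IHt ? /IHu ?]; exact: polyfun_add.
- move=> t IHt /IHt ht; rewrite (_ : (fun a => _) =
    fun a : nat -> k => 0 - GRing.eval (mkseq a n) t).
    by apply: polyfun_sub => //; exact: polyfun_cst.
  by apply/funext => a; rewrite sub0r.
- move=> t IHt m /IHt ht; rewrite (_ : (fun a => _) =
    fun a : nat -> k => m%:R * GRing.eval (mkseq a n) t).
    by apply: polyfun_mul => //; exact: polyfun_cst.
  by apply/funext => a; rewrite mulr_natl.
- by move=> t IHt u IHu /andP[/IHt ? /IHu ?]; exact: polyfun_mul.
- move=> t IHt m /IHt ht; elim: m => [|m IHm].
    by under eq_fun do rewrite expr0; exact: polyfun_cst.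
  by under eq_fun do rewrite exprS; exact: polyfun_mul.
Qed.

Lemma formula_constr n (f : GRing.formula k) : GRing.qf_form f && GRing.rformula f ->
  constructible [set a : nat -> k | GRing.qf_eval (mkseq a n) f].
Proof.
elim: f => //=.
- by move=> b _; exact: (constructible_cst k nat b).
- move=> t u /andP[rt ru];
  apply: constructible_ext (constructible_eq (term_polyfun n rt) (term_polyfun n ru)).
  by move=> a /=; split=> /eqP.
- move=> f IHf g IHg /andP[/andP[qf qg] /andP[rf rg]].
  apply: constructible_ext (constructibleI (IHf _) (IHg _)); rewrite ?qf ?qg //.
  by move=> a /=; split=> [[-> ->]//|/andP].
- move=> f IHf g IHg /andP[/andP[qf qg] /andP[rf rg]].
  apply: constructible_ext (constructibleU (IHf _) (IHg _)); rewrite ?qf ?qg //.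
  by move=> a /=; split=> [[->//|->]|/orP]; rewrite ?orbT.
- move=> f IHf g IHg /andP[/andP[qf qg] /andP[rf rg]].
  apply: constructible_ext (constructibleU (constructibleC (IHf _)) (IHg _));
    rewrite ?qf ?qg //.
  by move=> a /=; case: (GRing.qf_eval _ f) => /=; split=> //; [case|right|left].
- move=> f IHf /IHf cf; apply: constructible_ext (constructibleC cf) => a /=.
  by split=> /negP.
Qed.

(** Chevalley's theorem for one variable, from quantifier elimination for
    algebraically closed fields. *)
Lemma constructible_proj (D : set (nat -> k)) i : constructible D ->
  constructible [set a | exists c, D (upd a i c)].
Proof.
move=> /constructible_formula[f [N [wff fD]]].
pose g := GRing.quantifier_elim (@ClosedFieldQE.ex_elim k) (GRing.Exists i f).
have rg : GRing.rformula (GRing.Exists i f) by case/andP: wff.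
have wfg : GRing.qf_form g && GRing.rformula g.
  by apply: GRing.quantifier_elim_wf rg; exact: ClosedFieldQE.wf_ex_elim.
apply: constructible_ext (formula_constr (maxn N i.+1) wfg) => a /=.
have E c : set_nth 0 (mkseq a (maxn N i.+1)) i c = mkseq (upd a i c) (maxn N i.+1).
  apply: (@eq_from_nth _ 0) => [|j].
    by rewrite size_set_nth !size_mkseq; apply/maxn_idPr; exact: leq_maxr.
  rewrite size_set_nth size_mkseq (maxn_idPr (leq_maxr _ _)) => jn.
  by rewrite nth_set_nth /= !nth_mkseq.
have QE := GRing.quantifier_elim_rformP (@ClosedFieldQE.wf_ex_elim k)
  (ClosedFieldQE.holds_ex_elim (@solve_monicpoly k)) (mkseq a (maxn N i.+1)) rg.
split.
  move=> /QE[c]; rewrite E => H; exists c; apply/(fD (maxn N i.+1)).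
    exact: leq_maxl.
  by apply/GRing.qf_evalP => //; case/andP: wff.
move=> [c /(fD _ _ (leq_maxl N i.+1)) H]; apply/QE; exists c; rewrite E.
by apply/GRing.qf_evalP => //; case/andP: wff.
Qed.

Lemma constructible_support (D : set (nat -> k)) : constructible D ->
  exists N, forall a b, (forall i, (i < N)%N -> a i = b i) -> D a -> D b.
Proof.
move=> /constructible_formula[f [N [_ fD]]]; exists N => a b ab /(fD N a (leqnn N)) Da.
apply/(fD N b (leqnn N)); rewrite (_ : mkseq b N = mkseq a N)//.
by apply/eq_in_map => i; rewrite mem_iota => /ab.
Qed.

(** Partial solutions of D, seen as a condition on full assignments so that
    constructibility applies to them. *)
Definition extends n (D : set (nat -> k)) : set (nat -> k) :=
  [set a | exists2 b, D b & forall i, (i < n)%N -> b i = a i].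

Lemma extendsS n D a : extends n D a <-> exists c, extends n.+1 D (upd a n c).
Proof.
split=> [[b Db ba]|[c [b Db ba]]].
  exists (b n), b => // i; rewrite /upd; case: eqP => [->//|/eqP ni].
  by rewrite ltnS leq_eqVlt (negbTE ni); exact: ba.
exists b => // i iltn; rewrite ba ?(leqW iltn)// /upd.
by case: eqP iltn => // ->; rewrite ltnn.
Qed.

(** Beyond the support of D the prefix condition is D itself; going down, each
    step eliminates one variable. *)
Lemma constructible_extends n D : constructible D -> constructible (extends n D).
Proof.
move=> cD; have [N ND] := constructible_support cD.
suff H d m : (N <= m + d)%N -> constructible (extends m D) by apply: (H N); exact: leq_addl.
elim: d m => [|d IHd] m.
  rewrite addn0 => Nm; apply: constructible_ext cD => a; split; first by exists a.
  by move=> [b Db ba]; apply: ND Db => i /leq_trans/(_ Nm)/ba.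
rewrite addnS -addSn => /IHd/(constructible_proj m); apply: constructible_ext => a.
by split=> /extendsS.
Qed.

(** On a line, a polynomial vanishes everywhere or has finitely many roots, so
    a constructible set is finite or cofinite there. *)
Lemma constructible_line (D : set (nat -> k)) a i : constructible D ->
  exists s : seq k, (forall c, D (upd a i c) -> c \in s) \/
                    (forall c, c \notin s -> D (upd a i c)).
Proof.
elim=> [f pf|C E _ [s Cs] _ [s' Es']|C _ [s Cs]].
- have [p fp] : exists p : {poly k}, forall c, f (upd a i c) = p.[c].
    elim: pf => [c|v|g g' _ [p gp] _ [q gq]|g g' _ [p gp] _ [q gq]].
    + by exists c%:P => c'; rewrite hornerC.
    + rewrite /upd; case: eqP => _; first by exists 'X => c; rewrite hornerX.
      by exists (a v)%:P => c; rewrite hornerC.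
    + by exists (p + q) => c; rewrite hornerD gp gq.
    + by exists (p * q) => c; rewrite hornerM gp gq.
  have [p0|pn0] := eqVneq p 0.
    by exists [::]; right=> c _ /=; rewrite fp p0 horner0.
  have [s sp] := closed_field_poly_normal p.
  exists s; left=> c /=; rewrite fp => /rootP; rewrite sp rootZ ?lead_coef_eq0//.
  by rewrite root_prod_XsubC.
- exists (s ++ s'); case: Cs => Cs.
    by left=> c [/Cs cs _]; rewrite mem_cat cs.
  case: Es' => Es'; first by left=> c [_ /Es' cs']; rewrite mem_cat cs' orbT.
  by right=> c; rewrite mem_cat negb_or => /andP[/Cs ? /Es' ?].
- exists s; case: Cs => Cs; first by right=> c /negP cs /Cs.
  by left=> c nC; apply/negPn/negP => /Cs.
Qed.

End Projection.

(** * Saturation of uncountable algebraically closed fields *)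

(** If some term is finite, the sequence is eventually constant.  Otherwise the
    complements are finite and their countable union cannot exhaust k. *)
Lemma chain_meets (k : closedFieldType) (T : nat -> set k) :
  ~ countable [set: k] ->
  (forall m n, (m <= n)%N -> T n `<=` T m) -> (forall m, T m !=set0) ->
  (forall m, exists s : seq k, (forall c, T m c -> c \in s) \/
                               (forall c, c \notin s -> T m c)) ->
  exists c, forall m, T m c.
Proof.
move=> hk Tdec Tne Tfin.
have [[m [s Ts]]|nofin] := pselect (exists m (s : seq k), forall c, T m c -> c \in s).
  apply: contrapT => noc.
  have /choice[M HM] : forall c, exists n, ~ T n c.
    by move=> c; apply/existsNP => Tc; apply: noc; exists c.
  (* a point of a term which lies beyond all the failures M c, c in s *)
  have [c Tc] := Tne (maxn m (\max_(c <- s) M c)%N).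
  have cs : c \in s by apply: Ts; apply: Tdec Tc; exact: leq_maxl.
  apply: (HM c); apply: Tdec Tc; rewrite leq_max; apply/orP; right.
  by rewrite (big_rem c) //=; exact: leq_maxl.
have /choice[S HS] : forall m, exists s : seq k, forall c, c \notin s -> T m c.
  move=> m; have [s [Hs|Hs]] := Tfin m; last by exists s.
  by exfalso; apply: nofin; exists m, s.
apply: contrapT => noc; apply: hk.
apply: (@sub_countable _ _ _ (\bigcup_m [set` S m])); last first.
  by apply: bigcup_countable => // m _; exact/finite_set_countable/finite_seq.
apply: subset_card_le => c _; apply: contrapT => nc; apply: noc; exists c => m.
by apply: HS; apply/negP => cS; apply: nc; exists m.
Qed.

(** The invariant P n a says that the first n values of a extend to a solution
    of each finite part of the list.  [chain_meets] provides a value for the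
    next variable which serves all finite parts at once. *)
Lemma constructible_saturated_nat (k : closedFieldType) (C : nat -> set (nat -> k)) :
  ~ countable [set: k] -> (forall n, constructible (C n)) ->
  (forall m, exists a, forall i, (i <= m)%N -> C i a) ->
  exists a, forall i, C i a.
Proof.
move=> hk cC fin; pose D m : set (nat -> k) := [set a | forall i : 'I_m.+1, C i a].
have cD m : constructible (D m) by apply: constructible_forall => i; exact: cC.
have Ddec m n : (m <= n)%N -> D n `<=` D m.
  move=> mn a Da i; apply: (Da (Ordinal (_ : i < n.+1)%N)).
  exact: leq_trans (ltn_ord i) _.
pose P n a := forall m, extends n (D m) a.
have /choice[c Hc] : forall na, exists c, P na.1 na.2 -> P na.1.+1 (upd na.2 na.1 c).
  move=> [n a] /=; have [Pna|] := pselect (P n a); last by exists 0.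
  have [c Hc] : exists c, forall m, extends n.+1 (D m) (upd a n c).
    apply: (chain_meets hk (T := fun m => [set c | extends n.+1 (D m) (upd a n c)])).
    - by move=> m m' mm' c [b /(Ddec _ _ mm')Db ba]; exists b.
    - by move=> m; exact/extendsS/Pna.
    - by move=> m; apply: constructible_line; exact: constructible_extends.
  by exists c.
pose A := fix A n := if n is m.+1 then upd (A m) m (c (m, A m)) else fun=> 0.
have PA n : P n (A n).
  elim: n => [m|n IHn]; last exact: (Hc (n, A n)).
  by have [a Ha] := fin m; exists a => // i; apply: Ha; rewrite -ltnS.
have Aeq n i : (i < n)%N -> A n i = A i.+1 i.
  elim: n => // n IHn; rewrite ltnS leq_eqVlt => /orP[/eqP->//|iltn].
  by rewrite -(IHn iltn) /= /upd; case: eqP iltn => // ->; rewrite ltnn.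
exists (fun i => A i.+1 i) => i; have [N HN] := constructible_support (cC i).
have [b Db bA] := PA N i.
by apply: HN (Db ord_max) => j jN; rewrite bA// Aeq.
Qed.

Lemma constructible_saturated (k : closedFieldType) (V : Type) (C : nat -> set (V -> k)) :
  ~ countable [set: k] ->
  countable [set: V] -> (forall n, constructible (C n)) ->
  (forall m, exists a, forall i, (i <= m)%N -> C i a) ->
  exists a, forall i, C i a.
Proof.
move=> hk /countable_injP[f finj] cC fin.
have finj' : injective f by move=> u v; apply: finj; rewrite in_setE.
pose C' n : set (nat -> k) := [set b | C n (fun v => b (f v))].
have [|b Cb] := @constructible_saturated_nat k C' hk
  (fun n => constructible_reindex f (cC n)).
  move=> m; have [a Ca] := fin m.
  have /choice[b ab] : forall n, exists c, forall v, f v = n -> c = a v.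
    move=> n; have [[v <-]|nv] := pselect (exists v, f v = n).
      by exists (a v) => w /finj' ->.
    by exists 0 => v fv; exfalso; apply: nv; exists v.
  exists b => i /Ca; rewrite /C' /= (_ : (fun v => b (f v)) = a)//.
  by apply/funext => v; exact: ab.
by exists (fun v => b (f v)).
Qed.

(** * Hilbert's basis theorem *)

Section Noetherian.

Definition ideal (R : comNzRingType) (J : set R) : Prop :=
  [/\ J 0, forall x y, J x -> J y -> J (x + y) & forall c x, J x -> J (c * x)].

(** Defining the generated ideal as an intersection lets the proofs below avoid
    all explicit linear combinations. *)
Definition gen (R : comNzRingType) (S : set R) : set R :=
  [set x | forall J, ideal J -> S `<=` J -> J x].

Definition noetherian (R : comNzRingType) : Prop :=
  forall J : set R, ideal J ->
    exists t : seq R, [set` t] `<=` J /\ J `<=` gen [set` t].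

Lemma gen_ideal (R : comNzRingType) (S : set R) : ideal (gen S).
Proof.
split=> [J [] //|x y Sx Sy J iJ SJ|c x Sx J iJ SJ].
  by have [_ + _] := iJ; apply; [exact: Sx|exact: Sy].
by have [_ _ +] := iJ; apply; exact: Sx.
Qed.

Lemma sub_gen (R : comNzRingType) (S : set R) : S `<=` gen S.
Proof. by move=> x Sx J _; exact. Qed.

Lemma gen_sub (R : comNzRingType) (S J : set R) : ideal J -> S `<=` J -> gen S `<=` J.
Proof. by move=> iJ SJ x; exact. Qed.

Lemma gen_mono (R : comNzRingType) (S T : set R) : S `<=` T -> gen S `<=` gen T.
Proof. by move=> ST x Sx J iJ TJ; apply: Sx => // y /ST/TJ. Qed.

Lemma gen_finitary (R : comNzRingType) (S : set R) x : gen S x ->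
  exists2 t : seq R, [set` t] `<=` S & gen [set` t] x.
Proof.
have cat2 (t u : seq R) : [set` t] `<=` S -> [set` u] `<=` S -> [set` t ++ u] `<=` S.
  by move=> tS uS y /=; rewrite mem_cat => /orP[/tS|/uS].
move=> /(_ [set y | exists2 t : seq R, [set` t] `<=` S & gen [set` t] y]); apply.
- split; first by exists [::]; [|have [] := gen_ideal [set` [::] : seq R]].
  + move=> y z [t tS ty] [u uS uz]; exists (t ++ u); first exact: cat2.
    have [_ + _] := gen_ideal [set` t ++ u]; apply.
      by apply: gen_mono ty => w /= wt; rewrite mem_cat wt.
    by apply: gen_mono uz => w /= wu; rewrite mem_cat wu orbT.
  + by move=> c y [t tS ty]; exists t => //; have [_ _] := gen_ideal [set` t]; apply.
- move=> y Sy; exists [:: y]; first by move=> z /=; rewrite inE => /eqP->.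
  by apply: sub_gen; rewrite /= inE.
Qed.

(** In a noetherian ring the finitely many generators can be taken from any
    prescribed generating set. *)
Lemma noetherian_set (R : comNzRingType) (S : set R) : noetherian R ->
  exists2 t : seq R, [set` t] `<=` S & S `<=` gen [set` t].
Proof.
move=> /(_ _ (gen_ideal S))[s [sS Ss]].
suff [t tS st] : exists2 t : seq R, [set` t] `<=` S & [set` s] `<=` gen [set` t].
  by exists t => // x /sub_gen/Ss; apply: (gen_sub (gen_ideal _) st).
elim: s sS {Ss} => [|y s IHs] sS; first by exists [::].
have [|t tS st] := IHs; first by move=> z zs; apply: sS; rewrite /= inE [z \in s]zs orbT.
have [|u uS yu] := @gen_finitary _ S y; first by apply: sS; rewrite /= mem_head.
exists (t ++ u); first by move=> z /=; rewrite mem_cat => /orP[/tS|/uS].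
have tt : gen [set` t] `<=` gen [set` t ++ u].
  by apply: gen_mono => w /= wt; rewrite mem_cat wt.
have uu : gen [set` u] `<=` gen [set` t ++ u].
  by apply: gen_mono => w /= wu; rewrite mem_cat wu orbT.
by move=> z /=; rewrite inE => /orP[/eqP->|/st/tt//]; exact: uu.
Qed.

Lemma noetherian_field (F : fieldType) : noetherian F.
Proof.
move=> J iJ; have [[x [Jx x0]]|J0] := pselect (exists x, J x /\ x != 0).
  exists [:: x]; split=> [y /=|y _]; first by rewrite inE => /eqP->.
  have [_ _ +] := gen_ideal [set` [:: x]] => /(_ (y / x) x).
  by rewrite divfK//; apply; apply: sub_gen; rewrite /= inE.
exists [::]; split=> // x Jx; have [x0|x0] := eqVneq x 0.
  by rewrite x0; have [] := gen_ideal [set` [::] : seq F].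
by exfalso; apply: J0; exists x.
Qed.

(** Were J not finitely generated, one could choose p 0, p 1, ... in J, each of
    minimal degree outside the ideal generated by the previous ones.  The
    leading coefficient of some p N lies in the ideal generated by the previous
    ones, hence is also the coefficient of the same degree of some h in the
    ideal generated by the previous p i, and p N - h contradicts minimality. *)
Lemma noetherian_poly (R : comNzRingType) : noetherian R -> noetherian {poly R}.
Proof.
move=> nR J iJ; apply: contrapT => nfg.
have /choice[step stepP] : forall s : seq {poly R}, exists p, [set` s] `<=` J ->
    [/\ J p, ~ gen [set` s] p &
        forall q, J q -> ~ gen [set` s] q -> (size p <= size q)%N].
  move=> s; have [sJ|] := pselect ([set` s] `<=` J); last by exists 0.
  pose P m := `[< exists p, [/\ J p, ~ gen [set` s] p & size p = m] >].
  have exP : exists m, P m.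
    apply: contrapT => noP; apply: nfg; exists s; split=> // p Jp.
    by apply: contrapT => np; apply: noP; exists (size p); apply/asboolP; exists p.
  case: (ex_minnP exP) => m /asboolP[p [Jp np pm]] min; exists p => _.
  by split=> // q Jq nq; rewrite pm; apply: min; apply/asboolP; exists q.
pose s := fix s n := if n is m.+1 then step (s m) :: s m else [::].
pose p n := step (s n).
have sP n q : q \in s n <-> exists2 i, (i < n)%N & q = p i.
  elim: n => [|n IHn] /=; first by split=> // -[].
  rewrite inE; split=> [/orP[/eqP->|/IHn[i ilt ->]]|[i]].
  - by exists n.
  - by exists i => //; exact: ltnW.
  - rewrite ltnS leq_eqVlt => /orP[/eqP-> ->|ilt qi]; first by rewrite eqxx.
    by apply/orP; right; apply/IHn; exists i.
have sJ n : [set` s n] `<=` J.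
  elim: n => [//|n IHn] q /=; rewrite inE => /orP[/eqP->|/IHn//].
  by have [] := stepP _ IHn.
have pP n := stepP _ (sJ n).
have gen_le m n : (m <= n)%N -> gen [set` s m] `<=` gen [set` s n].
  move=> mn; apply: gen_mono => q /sP[i ilt ->].
  by apply/sP; exists i => //; exact: leq_trans mn.
have size_le m n : (m <= n)%N -> (size (p m) <= size (p n))%N.
  move=> mn; have [_ _ min] := pP m; have [Jn nn _] := pP n.
  by apply: min => // /(gen_le _ _ mn).
have [t ta ta'] := noetherian_set [set lead_coef (p i) | i in setT] nR.
have [N tN] : exists N, forall x, x \in t -> exists2 i, (i < N)%N & x = lead_coef (p i).
  elim: t ta {ta'} => [|x t IHt] ta; first by exists 0%N.
  have [|N HN] := IHt; first by move=> y yt; apply: ta; rewrite /= inE [y \in t]yt orbT.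
  have [|i _ ix] := ta x; first by rewrite /= mem_head.
  exists (maxn N i.+1) => y; rewrite inE => /orP[/eqP->|/HN[j jN ->]].
    by exists i => //; exact: leq_maxr.
  by exists j => //; rewrite leq_max jN.
(* the possible coefficients in degree deg (p N) of the polynomials of at most
   that degree in the ideal of the previous p i *)
pose K : set R := [set r | exists h, [/\ J h, gen [set` s N] h,
  (size h <= size (p N))%N & h`_(size (p N)).-1 = r]].
have [J0 JD JM] := iJ; have [G0 GD GM] := gen_ideal [set` s N].
have iK : ideal K.
  split.
  - by exists 0; split; rewrite ?size_poly0 ?coef0.
  - move=> _ _ [h [Jh gh sh <-]] [h' [Jh' gh' sh' <-]]; exists (h + h').
    split; [exact: JD|exact: GD| |by rewrite coefD].
    by rewrite (leq_trans (size_polyD _ _))// geq_max sh.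
  - move=> c _ [h [Jh gh sh <-]]; exists (c%:P * h).
    split; [exact: JM|exact: GM| |by rewrite coefCM].
    by rewrite mul_polyC (leq_trans (size_scale_leq _ _)).
have [JN nN minN] := pP N.
have pn0 n : p n != 0.
  apply/eqP => pn0; have [_ + _] := pP n; apply; rewrite -/(p n) pn0.
  by have [] := gen_ideal [set` s n].
have Ka : K (lead_coef (p N)).
  suff tK : [set` t] `<=` K by apply: (gen_sub iK tK); apply: ta'; exists N.
  move=> _ /tN[i iN ->]; exists ('X^(size (p N) - size (p i)) * p i).
  have le := size_le i N (ltnW iN); split.
  - by apply: JM; have [] := pP i.
  - by apply: GM; apply: sub_gen; apply/sP; exists i.
  - by rewrite mulrC size_mulXn// subnK.
  - have -> : (size (p N)).-1 = (size (p N) - size (p i) + (size (p i)).-1)%N.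
      move: (pn0 i) le; rewrite -size_poly_gt0; case: (size (p i)) => // m _ le.
      by rewrite -{1}(subnK le) addnS.
    by rewrite coefXnM ltnNge leq_addr /= addKn -lead_coefE.
have [h [Jh gh sh hl]] := Ka.
have : (size (p N) <= size (p N - h)%R)%N.
  apply: minN; first by apply: JD => //; rewrite -mulN1r; exact: JM.
  by move=> /GD/(_ gh); rewrite subrK.
rewrite leqNgt => /negP; apply.
move: (pn0 N); rewrite -size_poly_gt0 => sN; rewrite -(prednK sN) ltnS.
apply/leq_sizeP => j; rewrite leq_eqVlt => /orP[/eqP<-|jl].
  by rewrite coefB hl lead_coefE subrr.
rewrite prednK// in jl.
by rewrite coefB !nth_default ?subr0// (leq_trans sh).
Qed.

End Noetherian.

(** The polynomial functions in finitely many variables are the image of an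
    iterated polynomial ring; the ring and its evaluations are kept abstract so
    that adjoining a variable is a mere induction step. *)
Lemma polyfun_ring (k : fieldType) (V : eqType) (s : seq V) :
  exists2 R : comNzRingType, noetherian R &
  exists ev : (V -> k) -> {rmorphism R -> k},
    (forall c, exists r, forall a, ev a r = c) /\
    forall v, v \in s -> exists r, forall a, ev a r = a v.
Proof.
elim: s => [|v s [R nR [ev [evc evv]]]].
  exists k; first exact: noetherian_field.
  by exists (fun _ => idfun : {rmorphism k -> k}); split=> // c; exists c.
exists {poly R}; first exact: noetherian_poly.
exists (fun a => horner_eval (a v) \o map_poly (ev a) : {rmorphism {poly R} -> k}).
split=> [c|w].
  have [r Hr] := evc c; exists r%:P => a.
  by rewrite /= /horner_eval map_polyC hornerC; exact: Hr.
rewrite inE => /orP[/eqP->|/evv[r Hr]].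
  by exists 'X => a; rewrite /= /horner_eval map_polyX hornerX.
by exists r%:P => a; rewrite /= /horner_eval map_polyC hornerC; exact: Hr.
Qed.

(** The form in which the basis theorem is used: finitely many members of a
    family of polynomial functions have the same common zeros as the family. *)
Lemma polyfun_noetherian (k : fieldType) (V : finType) (Q : set ((V -> k) -> k)) :
  Q `<=` @polyfun k V ->
  exists (n : nat) (q : 'I_n -> (V -> k) -> k), (forall i, Q (q i)) /\
    forall a, (forall i, q i a = 0) -> forall f, Q f -> f a = 0.
Proof.
have [R nR [ev [evc evv]]] := polyfun_ring k (enum V).
have evf f : polyfun f -> exists r, forall a, ev a r = f a.
  elim=> [//|v|g g' _ [r rg] _ [r' rg']|g g' _ [r rg] _ [r' rg']].
  - by apply: evv; rewrite mem_enum.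
  - by exists (r + r') => a; rewrite rmorphD rg rg'.
  - by exists (r * r') => a; rewrite rmorphM rg rg'.
move=> Qp; pose S : set R := [set r | Q (fun a => ev a r)].
have [t tS St] := noetherian_set S nR.
exists (size t), (fun i a => ev a t`_i); split.
  by move=> i; apply: tS; rewrite /= mem_nth.
move=> a ta f Qf; have [r rf] := evf _ (Qp _ Qf).
rewrite -rf; have /St : S r by rewrite /S /= (_ : (fun b => ev b r) = f)//; apply/funext.
apply: (gen_sub (J := [set r | ev a r = 0])).
  split=> /= [|x y x0 y0|c x x0]; first exact: rmorph0.
    by rewrite rmorphD x0 y0 addr0.
  by rewrite rmorphM x0 mulr0.
move=> x /= xt; rewrite -(nth_index 0 xt).
by move: xt; rewrite -index_mem => xt; exact: (ta (Ordinal xt)).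
Qed.

(** * Functions that are locally fractions *)

Section LocalFractions.
Variables (k : fieldType) (S V : Type) (B : set S) (phi : S -> V -> k) (p : S).

(** Around p, within B, the set W is a neighbourhood on which f is a fraction of
    polynomials in the coordinates phi.  Joining the two conditions makes the
    predicate stable under the operations on germs of regular functions. *)
Definition locfrac (W : set S) (f : S -> k) : Prop :=
  exists a b, [/\ polyfun a, polyfun b, b (phi p) != 0 &
    forall q, B q -> b (phi q) != 0 -> W q /\ f q = a (phi q) / b (phi q)].

Lemma locfrac_sub (W W' : set S) f f' :
  (forall q, B q -> W q -> W' q /\ f' q = f q) -> locfrac W f -> locfrac W' f'.
Proof.
move=> sub [a [b [pa pb bp fab]]]; exists a, b; split=> // q Bq bq.
by have [Wq fq] := fab q Bq bq; have [W'q ->] := sub q Bq Wq.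
Qed.

Lemma locfrac_poly f : polyfun f -> locfrac setT (fun q => f (phi q)).
Proof.
move=> pf; exists f, (fun=> 1); split=> //; first exact: polyfun_cst.
  exact: oner_neq0.
by move=> q _ _; rewrite divr1.
Qed.

Lemma locfrac_add (W W' : set S) f f' : locfrac W f -> locfrac W' f' ->
  locfrac (W `&` W') (fun q => f q + f' q).
Proof.
move=> [a [b [pa pb bp fab]]] [a' [b' [pa' pb' bp' fab']]].
exists (fun v => a v * b' v + a' v * b v), (fun v => b v * b' v); split.
- by apply: polyfun_add; exact: polyfun_mul.
- exact: polyfun_mul.
- by rewrite mulf_neq0.
- move=> q Bq; rewrite mulf_eq0 negb_or => /andP[bq bq'].
  have [Wq ->] := fab q Bq bq; have [Wq' ->] := fab' q Bq bq'.
  by split=> //; rewrite addf_div.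
Qed.

Lemma locfrac_mul (W W' : set S) f f' : locfrac W f -> locfrac W' f' ->
  locfrac (W `&` W') (fun q => f q * f' q).
Proof.
move=> [a [b [pa pb bp fab]]] [a' [b' [pa' pb' bp' fab']]].
exists (fun v => a v * a' v), (fun v => b v * b' v); split.
- exact: polyfun_mul.
- exact: polyfun_mul.
- by rewrite mulf_neq0.
- move=> q Bq; rewrite mulf_eq0 negb_or => /andP[bq bq'].
  have [Wq ->] := fab q Bq bq; have [Wq' ->] := fab' q Bq bq'.
  by split=> //; rewrite mulf_div.
Qed.

Lemma locfrac_inv (W : set S) f : B p -> f p != 0 -> locfrac W f ->
  locfrac (W `&` [set q | f q != 0]) (fun q => (f q)^-1).
Proof.
move=> Bp fp [a [b [pa pb bp fab]]].
exists (fun v => b v * b v), (fun v => a v * b v); split.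
- exact: polyfun_mul.
- exact: polyfun_mul.
- rewrite mulf_neq0//; apply: contraNneq fp => ap.
  by have [_ ->] := fab p Bp bp; rewrite ap mul0r.
- move=> q Bq; rewrite mulf_eq0 negb_or => /andP[aq bq].
  have [Wq fq] := fab q Bq bq; split.
    by split=> //=; rewrite fq mulf_neq0// invr_neq0.
  by rewrite fq invf_div -mulf_div divff// mulr1.
Qed.

Lemma locfrac_prod (I : finType) (W : I -> set S) (f : I -> S -> k) :
  (forall i, locfrac (W i) (f i)) ->
  locfrac [set q | forall i, W i q] (fun q => \prod_i f i q).
Proof.
move=> Wf; have : locfrac [set q | forall i, i \in index_enum I -> W i q]
    (fun q => \prod_(i <- index_enum I) f i q).
  elim: (index_enum I) => [|i s IHs].
    by apply: locfrac_sub (locfrac_poly (polyfun_cst V 1)) => q _ _; rewrite big_nil.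
  apply: locfrac_sub (locfrac_mul (Wf i) IHs) => q _ [Wi Ws]; split.
    by move=> j; rewrite inE => /orP[/eqP->|/Ws].
  by rewrite big_cons.
by apply: locfrac_sub => q _ Wq; split=> // i; apply: Wq; exact: mem_index_enum.
Qed.

Lemma locfrac_sum (J : Type) (s : seq J) (W : set S) (f : J -> S -> k) :
  locfrac W (fun=> 0) -> (forall j, locfrac W (f j)) ->
  locfrac W (fun q => \sum_(j <- s) f j q).
Proof.
move=> W0 Wf; elim: s => [|j s IHs].
  by apply: locfrac_sub W0 => q _ Wq; rewrite big_nil.
by apply: locfrac_sub (locfrac_add (Wf j) IHs) => q _ [Wq _]; rewrite big_cons.
Qed.

End LocalFractions.

(** * Charts and codings of varieties *)

Section Charts.
Variable k : fieldType.

(** A chart is not asked to be a homeomorphism onto its image: it suffices that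
    the polynomials in its coordinates are fine enough to describe open sets
    and regular functions.  This leaves room for redundant coordinates. *)
Definition chart (S : fspace k) (V : finType) (B : set S) (phi : S -> V -> k) : Prop :=
  constructible (phi @` B) /\
  forall (U : set S) (f : S -> k) p, open U -> regular S U f -> B p -> U p ->
    locfrac B phi p U f.

(** Extension by zero keeps the coordinates of a local chart meaningful on the
    whole space. *)
Definition ext0 (S : Type) (U : set S) (g : S -> k) (p : S) : k :=
  if `[< U p >] then g p else 0.

Lemma ext0E (S : Type) (U : set S) (g : S -> k) p : U p -> ext0 U g p = g p.
Proof. by move=> Up; rewrite /ext0; case: asboolP. Qed.

Lemma ext0N (S : Type) (U : set S) (g : S -> k) p : ~ U p -> ext0 U g p = 0.
Proof. by move=> Up; rewrite /ext0; case: asboolP. Qed.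

(** The denominators b of all local descriptions g = a / b within U form a
    family of polynomials.  By the basis theorem finitely many of them have the
    same common zeros, and they give finitely many equations b g = a. *)
Lemma chart_graph (S : fspace k) (V : finType) (B : set S) (phi : S -> V -> k)
    (U : set S) (g : S -> k) : chart B phi -> open U -> regular S U g ->
  constructible [set w : option V -> k | exists2 p, B p &
    phi p = w \o Some /\ w None = ext0 U g p].
Proof.
move=> [cB lf] oU rg.
pose num b a := polyfun a /\ forall q, B q -> b (phi q) != 0 ->
  U q /\ g q = a (phi q) / b (phi q).
have [|n [b [Qb b0]]] := @polyfun_noetherian k V
    [set b | polyfun b /\ exists a, num b a]; first by move=> b [].
have pb i : polyfun (b i) by have [] := Qb i.
have /choice[a Ha] : forall i, exists a, num (b i) a by move=> i; have [] := Qb i.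
have pa i : polyfun (a i) by have [] := Ha i.
have covers q : B q -> U q -> exists i, b i (phi q) != 0.
  move=> Bq Uq; apply: contrapT => nb.
  have [a' [b' [pa' pb' bq fab]]] := lf _ _ _ oU rg Bq Uq.
  move/eqP: bq; apply; apply: b0; last by split=> //; exists a'.
  by move=> i; apply/eqP/negPn/negP => bi; apply: nb; exists i.
have pS f : polyfun f -> polyfun (fun w : option V -> k => f (w \o Some)).
  by apply: (polyfun_subst (h := fun v w => w (Some v))) => v; exact: polyfun_var.
have pN : polyfun (fun w : option V -> k => w None) by exact: polyfun_var.
have c1 : constructible [set w : option V -> k | (phi @` B) (w \o Some)].
  exact: (constructible_reindex Some cB).
have c2 : constructible [set w : option V -> k | exists i, b i (w \o Some) != 0 /\
    w None * b i (w \o Some) = a i (w \o Some)].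
  apply: constructible_exists => i; apply: constructibleI.
    exact: constructible_neq0 (pS _ (pb i)).
  by apply: constructible_eq; [apply: polyfun_mul => //; exact: pS|exact: pS].
have c3 : constructible [set w : option V -> k | w None = 0 /\ forall i, b i (w \o Some) = 0].
  apply: constructibleI; first exact: constructible_zero.
  by apply: constructible_forall => i; apply: constructible_zero; exact: pS.
apply: constructible_ext (constructibleI c1 (constructibleU c2 c3)) => w; split.
  move=> [[p Bp pw] [[i [bi wi]]|[w0 bw]]]; exists p => //; split=> //.
    rewrite -pw in bi wi; have [_ /(_ p Bp bi)[Up gp]] := Ha i.
    by rewrite ext0E// gp -wi mulfK.
  rewrite ext0N// => Up; have [i /eqP] := covers p Bp Up.
  by apply; rewrite pw.
move=> [p Bp [pw wN]]; split; first by exists p.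
have [Up|nUp] := pselect (U p); [left|right].
  have [i bi] := covers p Bp Up; exists i; rewrite -pw; split=> //.
  have [_ /(_ p Bp bi)[_ gp]] := Ha i.
  by rewrite wN ext0E// gp divfK.
rewrite /= -pw wN ext0N//; split=> // i; apply/eqP/negPn/negP => bi.
by have [_ /(_ p Bp bi)[]] := Ha i.
Qed.

Lemma chart_open (S : fspace k) (V : finType) (B : set S) (phi : S -> V -> k)
    (U : set S) : chart B phi -> open U -> constructible (phi @` (B `&` U)).
Proof.
move=> cB oU; have := chart_graph cB oU (regular_cst 1 oU).
move=> /(constructible_subst (h := fun o w => if o is Some v then w v else 1)) H.
apply: constructible_ext (H _) => [w|[v|]]; last 2 first.
- exact: polyfun_var.
- exact: polyfun_cst.
split=> [[p Bp [pw /=]]|[p [Bp Up] <-]].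
  rewrite /ext0; case: asboolP => [Up _|_ /eqP]; last by rewrite oner_eq0.
  by exists p.
by exists p => //; split=> //=; rewrite ext0E.
Qed.

(** Near p, belonging to U follows from the nonvanishing of a polynomial in the
    coordinates. *)
Lemma chart_sep (S : fspace k) (V : finType) (B : set S) (phi : S -> V -> k)
    (U : set S) p q : chart B phi -> open U -> B p -> B q -> phi p = phi q ->
  U p -> U q.
Proof.
move=> [_ lf] oU Bp Bq pq Up.
have [a [b [_ _ bp]]] := lf _ _ _ oU (regular_cst 1 oU) Bp Up.
by rewrite pq in bp => /(_ q Bq bp)[].
Qed.

Lemma chart_sub (S : fspace k) (V : finType) (B : set S) (phi : S -> V -> k)
    (Z : set S) : is_subvariety Z -> chart B phi ->
  @chart (sub_fspace Z) V (set_val @^-1` B) (phi \o set_val).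
Proof.
move=> [O [C [oO cC ZE]]] cB; have oC : open (~` C) by exact: closed_openC.
split.
  apply: constructible_ext (constructibleI (chart_open cB oO)
    (constructibleC (chart_open cB oC))).
  move=> w; split.
    move=> [[p [Bp Op] <-] nC].
    have Zp : Z p by rewrite ZE; split=> //; apply: contrapT => nCp; apply: nC; exists p.
    by exists (SigSub (mem_set Zp)).
  move=> [x Bx <-]; have := set_valP x; rewrite {1}ZE => -[Ox Cx]; split.
    by exists (set_val x).
  by move=> [q [Bq nCq] qx]; apply: (chart_sep cB oC Bq Bx qx nCq).
move=> U f p [U' oU' <-] rf Bp Up.
have [O' [g [oO' Op rg fg]]] := rf p Up.
have oI : open (O' `&` U') by exact: openI.
have rI : regular S (O' `&` U') g by apply: (regular_sub oO' oI _ rg) => y [].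
have [a [b [pa pb bp gab]]] := cB.2 _ _ _ oI rI Bp (conj Op Up).
exists a, b; split=> // q Bq bq; have [[Oq Uq] <-] := gab _ Bq bq.
by split=> //; exact: fg.
Qed.

Lemma chart_iso (S T : fspace k) (V : finType) (B : set T) (phi : T -> V -> k)
    (f : S -> T) (g : T -> S) : cancel f g -> cancel g f -> morphism g ->
  chart B phi -> chart (f @^-1` B) (phi \o f).
Proof.
move=> fK gK [gc gr] [cB lf]; split.
  apply: constructible_ext cB => w; split=> [[y By <-]|[x Bx <-]]; last by exists (f x).
  by exists (g y) => /=; rewrite gK.
move=> U h p oU rh Bp Up.
have ogU : open (g @^-1` U) by move/continuousP: gc; exact.
have [|a [b [pa pb bp hab]]] := lf _ _ (f p) ogU (gr _ _ oU rh) Bp.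
  by rewrite /= fK.
exists a, b; split=> // q Bq bq; have [] := hab (f q) Bq bq.
by rewrite /= fK.
Qed.

Lemma chart_from_sub (S : fspace k) (V : finType) (U : set S)
    (phi : S -> V -> k) : open U ->
  @chart (sub_fspace U) V setT (phi \o set_val) -> chart U phi.
Proof.
move=> oU [cU lf]; split.
  apply: constructible_ext cU => w; split=> [[x _ <-]|[x Ux <-]].
    by exists (set_val x) => //; exact: set_valP.
  by exists (SigSub (mem_set Ux)).
move=> O h p oO rh Up Op.
have oV : open (set_val @^-1` O : set (sub_fspace U)) by exists O.
have rV : regular (sub_fspace U) (set_val @^-1` O) (h \o set_val).
  by move=> x Ox; exists O, h.
have [a [b [pa pb bp hab]]] := lf _ _ (SigSub (mem_set Up)) oV rV I Op.
by exists a, b; split=> // q Uq bq; have := hab (SigSub (mem_set Uq)) I bq.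
Qed.

Lemma regular_from_sub (S : fspace k) (U : set S) (h : S -> k) : open U ->
  regular (sub_fspace U) setT (h \o set_val) -> regular S U h.
Proof.
move=> oU rh; apply: regular_glue => // x Ux.
have [O [g [oO Ox rg hg]]] := rh (SigSub (mem_set Ux)) I.
have oI : open (U `&` O) by exact: openI.
exists (U `&` O); split=> //.
apply: (regular_ext oI (f := g)).
  by move=> y [Uy Oy]; rewrite -(hg (SigSub (mem_set Uy))).
by apply: (regular_sub oO oI _ rg) => y [].
Qed.

(** It suffices to check the generating functions, for affine spaces and
    products alike. *)
Lemma fraction_locfrac (T : choiceType) (F : @fraction_base k T) (V : finType)
    (B : set (fb_type F)) (phi : fb_type F -> V -> k) :
  (forall W f p, fb_fun F W f -> B p -> W p -> locfrac B phi p W f) ->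
  forall U f p, open U -> regular (fraction_fspace F) U f -> B p -> U p ->
    locfrac B phi p U f.
Proof.
move=> lf U f p oU rf Bp Up.
have [W [b [Wp Fb bp WU]]] : exists (W : set T) (b : T -> k),
    [/\ W p, fb_fun F W b, b p != 0 & W `&` [set q | b q != 0] `<=` U] := oU p Up.
have [W' [a [c [Wp' Fa Fc cp fac]]]] := rf p Up.
have lW := locfrac_inv Bp bp (lf _ _ _ Fb Bp Wp).
have lW' := locfrac_mul (lf _ _ _ Fa Bp Wp') (locfrac_inv Bp cp (lf _ _ _ Fc Bp Wp')).
have l1 := locfrac_mul lW (locfrac_poly B phi p (polyfun_cst V 0)).
apply: locfrac_sub (locfrac_add l1 lW') => q Bq [[Wq _] [W'q [_ cq]]].
have Uq : U q by exact: WU.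
by split=> //; rewrite mulr0 add0r; exact: fac.
Qed.

Lemma chart_affine n : @chart (affine_space k n) 'I_n setT id.
Proof.
split.
  by apply: constructible_ext (constructible_cst k 'I_n True) => w; split=> // _; exists w.
apply: fraction_locfrac => W f p [-> [P ->]] _ _.
apply: (@locfrac_poly k _ _ setT id p (fun v => mpoly.meval v P)).
elim/mpoly.mpolyind: P => [|c m P _ _ IHP].
  by under eq_fun do rewrite mpoly.meval0; exact: polyfun_cst.
under eq_fun do rewrite mpoly.mevalD mpoly.mevalZ mpoly.mevalX.
apply: polyfun_add => //; apply: polyfun_mul; first exact: polyfun_cst.
elim: (index_enum _) => [|i s IHs].
  by under eq_fun do rewrite big_nil; exact: polyfun_cst.
under eq_fun do rewrite big_cons; apply: polyfun_mul => //.
elim: (mpoly.fun_of_multinom m i) => [|e IHe].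
  by under eq_fun do rewrite expr0; exact: polyfun_cst.
by under eq_fun do rewrite exprS; apply: polyfun_mul => //; exact: polyfun_var.
Qed.

(** A generating function of a product is a sum of products of functions of a
    single factor, and each of them is a fraction in the coordinates of that
    factor. *)
Lemma chart_prod (I V : finType) (X : fspace k) (B : I -> set X)
    (phi : X -> V -> k) : (forall i, chart (B i) phi) ->
  @chart (prod_fspace I X) (I * V)%type [set q | forall i, B i (q i)]
    (fun q iv => phi (q iv.1) iv.2).
Proof.
move=> cB; split.
  apply: constructible_ext (constructible_forall
    (fun i => constructible_reindex (fun v => (i, v)) (cB i).1)) => w; split.
    move=> Hw; have /choice[q Hq] : forall i, exists x,
        B i x /\ phi x = fun v => w (i, v).
      by move=> i; have [x Bx xw] := Hw i; exists x.
    exists q => [i|]; first by have [] := Hq i.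
    by apply/funext => -[i v] /=; have [_ ->] := Hq i.
  by move=> [q Bq <-] i; exists (q i).
apply: fraction_locfrac => W f p [U [oU -> [J [c [h [rh ->]]]]]] Bp Up.
have lh i g : regular X (U i) g -> locfrac [set q | forall i, B i (q i)]
    (fun (q : I -> X) (iv : I * V) => phi (q iv.1) iv.2) p
    [set q | U i (q i)] (fun q => g (q i)).
  move=> rg; have [a [b [pa pb bp gab]]] := (cB i).2 _ _ _ (oU i) rg (Bp i) (Up i).
  have ps u : polyfun u -> polyfun (fun w : I * V -> k => u (fun v => w (i, v))).
    by apply: (polyfun_subst (h := fun v w => w (i, v))) => v; exact: polyfun_var.
  exists (fun w => a (fun v => w (i, v))), (fun w => b (fun v => w (i, v))).
  by split; [exact: ps|exact: ps|exact: bp|move=> q Bq; exact: gab (Bq i)].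
have l1 := locfrac_prod (fun i => lh i _ (regular_cst 1 (oU i))).
have c0 (d : k) := locfrac_poly [set q | forall i, B i (q i)]
    (fun (q : I -> X) (iv : I * V) => phi (q iv.1) iv.2) p (polyfun_cst (I * V) d).
apply: locfrac_sum => [|j].
  by apply: locfrac_sub (locfrac_mul l1 (c0 0)) => q _ [Uq _]; rewrite mulr0.
have l2 := locfrac_prod (fun i => lh i _ (rh j i)).
by apply: locfrac_sub (locfrac_mul (c0 (c j)) l2) => q _ [_ Uq].
Qed.

(** Replacing the coordinates by a richer family psi keeps a chart as soon as
    the new coordinates are regular functions extended by zero: the image of
    psi is cut out by their graphs. *)
Lemma chart_refine (S : fspace k) (V W : finType) (B : set S)
    (phi : S -> V -> k) (psi : S -> W -> k) (s : V -> W) :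
  chart B phi -> {in B &, injective phi} ->
  (forall t, exists U g, [/\ open U, regular S U g & forall x, psi x t = ext0 U g x]) ->
  (forall x, B x -> phi x = psi x \o s) -> chart B psi.
Proof.
move=> cB phiI psiE psis; split.
  have /choice[U /choice[g Ug]] := psiE.
  have cG t : constructible [set w : W -> k | exists2 p, B p &
      phi p = w \o s /\ w t = ext0 (U t) (g t) p].
    have [oU rg _] := Ug t; have := chart_graph cB oU rg.
    by move=> /(constructible_reindex (fun o => if o is Some v then s v else t)).
  apply: constructible_ext (constructibleI (constructible_reindex s cB.1)
    (constructible_forall cG)) => w; split.
    move=> [[p Bp pw] Gw]; exists p => //; apply/funext => t.
    have [p' Bp' [pw' ->]] := Gw t; have [_ _ ->] := Ug t.
    by congr ext0; apply: phiI; rewrite ?in_setE// pw' pw.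
  move=> [p Bp <-]; split; first by exists p => //; exact: psis.
  move=> t; exists p => //; split; first exact: psis.
  by have [_ _] := Ug t.
move=> U f p oU rf Bp Up; have [a [b [pa pb bp fab]]] := cB.2 _ _ _ oU rf Bp Up.
have ps u : polyfun u -> polyfun (fun w : W -> k => u (w \o s)).
  by apply: (polyfun_subst (h := fun v w => w (s v))) => v; exact: polyfun_var.
exists (fun w => a (w \o s)), (fun w => b (w \o s)).
by split=> [|||q Bq]; rewrite -?psis//; [exact: ps|exact: ps|exact: fab].
Qed.

(** A single map enc serves all the pieces, so that points of different pieces
    have comparable coordinates. *)
Definition charted (S : fspace k) (V : finType) (enc : S -> V -> k) : Prop :=
  exists (J : finType) (B : J -> set S),
    (forall x, exists j, B j x) /\ forall j, chart (B j) enc.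

Lemma charted_image (S : fspace k) (V : finType) (enc : S -> V -> k) :
  charted enc -> constructible (range enc).
Proof.
move=> [J [B [covB cB]]].
apply: constructible_ext (constructible_exists (fun j => (cB j).1)) => w.
split=> [[j [x _ <-]]|[x _ <-]]; first by exists x.
by have [j Bx] := covB x; exists j, x.
Qed.

Lemma charted_prod (I V : finType) (X : fspace k) (enc : X -> V -> k) :
  charted enc -> @charted (prod_fspace I X) (I * V)%type
    (fun q iv => enc (q iv.1) iv.2).
Proof.
move=> [J [B [covB cB]]].
exists {ffun I -> J}, (fun j : {ffun I -> J} => [set q | forall i, B (j i) (q i)]); split.
  move=> q; have /choice[j Hj] := fun i => covB (q i).
  by exists [ffun i => j i] => i; rewrite ffunE.
by move=> j; apply: (chart_prod (B := fun i => B (j i))) => i; exact: cB.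
Qed.

Lemma charted_sub (S : fspace k) (V : finType) (enc : S -> V -> k) (Z : set S) :
  is_subvariety Z -> charted enc -> @charted (sub_fspace Z) V (enc \o set_val).
Proof.
move=> Zsub [J [B [covB cB]]]; exists J, (fun j => set_val @^-1` B j); split.
  by move=> x; exact: covB.
by move=> j; exact: chart_sub.
Qed.

(** Injectivity makes points comparable through their codes.  The last
    condition makes the codes of the values of a morphism constructible. *)
Definition coding (X : fspace k) (V : finType) (enc : X -> V -> k) : Prop :=
  [/\ injective enc, charted enc &
    forall v, exists U g, [/\ open U, regular X U g & forall x, enc x v = ext0 U g x]].

(** A coordinate of f s is the extension by zero of a regular function pulled
    back along f, so its graph is constructible by [chart_graph]; injectivity of
    phi makes the points provided by the different coordinates agree. *)
Lemma charted_morphism (S Y : fspace k) (V W : finType) (phi : S -> V -> k)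
    (enc : Y -> W -> k) (f : S -> Y) :
  charted phi -> injective phi -> coding enc -> morphism f ->
  constructible [set w : V + W -> k | exists s, phi s = w \o inl /\ enc (f s) = w \o inr].
Proof.
move=> [J [B [covB cB]]] phiI [_ _ encE] [fc fr].
have /choice[U /choice[g Ug]] := encE.
have cG j t : constructible [set w : V + W -> k | exists2 p, B j p & phi p = w \o inl /\
    w (inr t) = ext0 (f @^-1` U t) (g t \o f) p].
  have [oU rg _] := Ug t.
  have ofU : open (f @^-1` U t) by move/continuousP: fc; exact.
  have := chart_graph (cB j) ofU (fr _ _ oU rg).
  by move=> /(constructible_reindex (fun o => if o is Some v then inl v else inr t)).
have := constructible_exists (fun j =>
  constructibleI (constructible_reindex (inl : V -> V + W) (cB j).1)
    (constructible_forall (cG j))).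
apply: constructible_ext => w; split.
  move=> [j [[p Bp pw] Gw]]; exists p; split=> //; apply/funext => t.
  have [p' _ [pw' /= ->]] := Gw t; have [_ _ ->] := Ug t.
  by rewrite (phiI p' p)// pw'.
move=> [p [pw fw]]; have [j Bp] := covB p; exists j; split; first by exists p.
move=> t; exists p => //; split=> //.
by have [_ _ E] := Ug t; rewrite -[RHS]/(ext0 (U t) (g t) (f p)) -E fw.
Qed.

Lemma affine_chart (S : fspace k) (U : set S) : open U -> is_affine (sub_fspace U) ->
  exists c : {n & S -> 'I_n -> k},
    [/\ chart U (projT2 c), {in U &, injective (projT2 c)} &
        forall l, regular S U (fun x => projT2 c x l)].
Proof.
move=> oU [n [Z [cZ [f [g [fK gK mf mg]]]]]].
have fE (x : S) : exists v : 'I_n -> k, forall Ux : U x,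
    v = set_val (f (SigSub (mem_set Ux))).
  have [Ux|nUx] := pselect (U x); last by exists (fun=> 0).
  by exists (set_val (f (SigSub (mem_set Ux)))) => Ux';
    congr (set_val (f _)); apply: val_inj.
have [phi Hphi] := choice fE.
have phiE (x : sub_fspace U) : phi (set_val x) = set_val (f x).
  rewrite (Hphi _ (set_valP x)); congr (set_val (f _)); exact: val_inj.
exists (existT _ n phi) => /=; split.
- apply: chart_from_sub => //; have Zsub : is_subvariety Z.
    by exists setT, Z; split=> //; [exact: openT|rewrite setTI].
  have := chart_iso fK gK mg (chart_sub Zsub (@chart_affine n)).
  rewrite (_ : (id \o set_val) \o f = phi \o set_val)//.
  by apply/funext => x /=; rewrite phiE.
- move=> x y; rewrite !in_setE => Ux Uy; rewrite (Hphi _ Ux) (Hphi _ Uy).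
  by move=> /val_inj/(can_inj fK)/(congr1 val).
- move=> l; apply: regular_from_sub => //.
  have oZ : open (setT : set (sub_fspace Z)) by exact: openT.
  have rl : regular (sub_fspace Z) setT (fun z => set_val z l).
    move=> z _; exists setT, (fun v => v l); split=> //; first exact: openT.
    move=> v _; exists setT, (fun v => v l), (fun=> 1); split=> //.
    + split=> //; exists (mpoly.mpolyX _ (mpoly.mnm1 l)).
      by apply/funext => u; rewrite mpoly.mevalXU.
    + by split=> //; exists (mpoly.mpolyC n 1); apply/funext => u; rewrite mpoly.mevalC.
    + exact: oner_neq0.
    + by move=> *; rewrite divr1.
  have := mf.2 _ _ oZ rl; rewrite preimage_setT.
  rewrite (_ : _ \o f = (fun x => phi x l) \o set_val)//.
  by apply/funext => x /=; rewrite phiE.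
Qed.

End Charts.

(** Codes list the coordinates in all affine charts at once, extended by zero,
    together with a flag for each chart telling whether the point lies in it.
    Unlike the choice of a chart for each point, this is canonical, so that
    equality of points is equality of codes. *)
Lemma variety_coding (k : closedFieldType) (X : variety k) :
  exists (V : finType) (enc : X -> V -> k), coding enc.
Proof.
have [m [U [oU covU affU]]] := var_cover X.
have /choice[c Hc] := fun i => affine_chart (oU i) (affU i).
pose enc (x : X) (t : {i & option 'I_(projT1 (c i))}) : k :=
  match t with existT i o =>
    ext0 (U i) (if o is Some l then fun x => projT2 (c i) x l else fun=> 1) x end.
exists {i & option 'I_(projT1 (c i))}, enc.
have encE t : exists U g, [/\ open U, regular X U g & forall x, enc x t = ext0 U g x].
  case: t => i [l|]; first by exists (U i), (fun x => projT2 (c i) x l);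
    have [_ _ rc] := Hc i.
  by exists (U i), (fun=> 1); split=> //; exact: regular_cst.
have phiE i x : U i x -> projT2 (c i) x = enc x \o (fun l => existT _ i (Some l)).
  by move=> Ux; apply/funext => l /=; rewrite ext0E.
have cov x : exists i, U i x.
  by have : setT x by []; rewrite -covU => -[i _ Ux]; exists i.
split=> //.
- move=> x y xy; have [i Ux] := cov x; have [_ inj _] := Hc i.
  have Uy : U i y.
    have := congr1 (fun e => e (existT _ i None)) xy; rewrite /= ext0E//.
    by rewrite /ext0; case: asboolP => // _ /eqP; rewrite oner_eq0.
  by apply: inj; rewrite ?in_setE// !phiE// xy.
- exists 'I_m, U; split=> // i; have [ci inj _] := Hc i.
  exact: chart_refine ci inj encE (phiE i).
Qed.

(** * Invariance of finite type and soficity under conjugacy *)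

Section Conjugacy.
Variable G : monoidType.

Lemma restrP (A : Type) (E : {fset G}) (x y : G -> A) :
  restr (E := E) x = restr (E := E) y <-> forall e, e \in E -> x e = y e.
Proof.
split=> [xy e eE|xy]; first exact: (congr1 (fun r => r [` eE]%fset) xy).
by apply/funext => e; apply: xy; exact: valP.
Qed.

(** A sliding block map presented by its graph R.  In this form a map and its
    inverse are treated alike, and no value outside the domain is needed. *)
Definition block_rel (A B : Type) (R : (G -> A) -> (G -> B) -> Prop) (M : {fset G}) : Prop :=
  forall x y x' y' g h, R x y -> R x' y' ->
    (forall m, m \in M -> x (m * g)%g = x' (m * h)%g) -> y g = y' h.

Lemma block_rel_fun (A B : Type) (R : (G -> A) -> (G -> B) -> Prop) (M : {fset G}) x y y' :
  block_rel R M -> R x y -> R x y' -> y = y'.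
Proof. by move=> RM xy xy'; apply/funext => g; exact: RM xy xy' _. Qed.

Lemma ca_block (A B : Type) (Sigma : set (G -> A)) (tau : Sigma -> (G -> B)) :
  is_cellular_automaton tau ->
  exists M, block_rel (fun x y => exists2 s, set_val s = x & tau s = y) M.
Proof.
move=> [M [mu tauM]]; exists M => _ _ _ _ g h [s <- <-] [s' <- <-] ss'.
have [u uE ->] := tauM s g; have [v vE ->] := tauM s' h.
by congr mu; apply: val_inj; rewrite [LHS]uE [RHS]vE; exact/restrP.
Qed.

Lemma block_ca (A B : Type) (Sigma : set (G -> A)) (tau : Sigma -> (G -> B)) M :
  is_subshift Sigma ->
  block_rel (fun x y => exists2 s, set_val s = x & tau s = y) M ->
  is_cellular_automaton tau.
Proof.
move=> inv tauM; exists M.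
have lift (u : restr (E := M) @` Sigma) : exists s : Sigma,
    restr (E := M) (set_val s) = set_val u.
  by have [x Sx xu] := set_valP u; exists (SigSub (mem_set Sx)).
have [s Hs] := choice lift; exists (fun u => tau (s u) 1%g) => x g.
have uP : (restr (E := M) @` Sigma) (restr (E := M) (shift g (set_val x))).
  by exists (shift g (set_val x)) => //; apply: inv; exact: set_valP.
exists (SigSub (mem_set uP)) => //.
apply: tauM; [by exists x|by eexists|] => m mM; rewrite mulg1.
by have /restrP/(_ m mM) := Hs (SigSub (mem_set uP)).
Qed.

Lemma sft_subshift (A : Type) (D : {fset G}) (P : set (D -> A)) : is_subshift (sft P).
Proof.
move=> g x xP h; rewrite (_ : shift h (shift g x) = shift (h * g)%g x)//.
by apply/funext => m; rewrite /shift mulgA.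
Qed.

Definition mul_fset (M N : {fset G}) : {fset G} :=
  [fset (m * n)%g | m in M, n in N]%fset.

Lemma mem_mul_fset (M N : {fset G}) m n : m \in M -> n \in N ->
  (m * n)%g \in mul_fset M N.
Proof. by move=> mM nN; apply/imfset2P; exists m => //; exists n. Qed.

(** Composing a cellular automaton of memory N with one of memory M gives one of
    memory N M. *)
Lemma sofic_image (A B : Type) (R : (G -> A) -> (G -> B) -> Prop) M
    (Delta : set (G -> A)) : block_rel R M ->
  (forall x, Delta x -> exists y, R x y) -> is_sofic Delta ->
  is_sofic [set y | exists2 x, Delta x & R x y].
Proof.
move=> RM tot [C [Gamma [sigma [[D [P GammaE]] sca DeltaE]]]].
have [N sN] := ca_block sca.
have [|rho Hrho] := @choice _ _ (fun c y => R (sigma c) y).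
  by move=> c; apply: tot; rewrite DeltaE; exists c.
exists C, Gamma, rho; split; first by exists D, P.
  apply: (block_ca (M := mul_fset N M)); first by rewrite GammaE; exact: sft_subshift.
  move=> _ _ _ _ g h [c <- <-] [c' <- <-] cc'.
  apply: (RM _ _ _ _ g h (Hrho c) (Hrho c')) => m mM.
  apply: (sN (set_val c) _ (set_val c')); [by exists c|by exists c'|] => n nN.
  by rewrite !mulgA; apply: cc'; exact: mem_mul_fset.
apply/seteqP; split=> [y [x]|_ [c _ <-]].
  by rewrite DeltaE => -[c _ <-] /(block_rel_fun RM (Hrho c)) <-; exists c.
by exists (sigma c) => //; rewrite DeltaE; exists c.
Qed.

(** Membership of x in Delta is tested on windows E: each window of x extends to
    some w g in Delta, whose image v g lies in Delta'.  For E large enough the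
    values v g 1 form a configuration y with y (d g) = v g d for all d in D and
    in N.  The first makes y a point of Delta'; the second shows that the
    preimage of y is x. *)
Lemma sft_preimage (A B : Type) (R : (G -> A) -> (G -> B) -> Prop) M N
    (Delta : set (G -> A)) (Delta' : set (G -> B)) :
  block_rel R M -> block_rel (fun y x => R x y) N ->
  (forall x, Delta x -> exists2 y, Delta' y & R x y) ->
  (forall y, Delta' y -> exists2 x, Delta x & R x y) ->
  is_subshift Delta -> is_sft Delta' -> is_sft Delta.
Proof.
move=> RM RN tot tot' inv [D [P D'E]].
pose E := (1%g |` (M `|` (mul_fset M N `|` mul_fset M D)))%fset.
have E1 : 1%g \in E by rewrite !inE eqxx.
have EM m : m \in M -> m \in E by move=> mM; rewrite !inE mM orbT.
have EN m n : m \in M -> n \in N -> (m * n)%g \in E.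
  by move=> mM nN; rewrite 2!inE !(in_fsetU) mem_mul_fset// !orbT.
have ED m d : m \in M -> d \in D -> (m * d)%g \in E.
  by move=> mM dD; rewrite 2!inE !(in_fsetU) (mem_mul_fset mM dD) !orbT.
exists E, (restr (E := E) @` Delta); apply/seteqP; split=> [x Dx g|x xP].
  by exists (shift g x) => //; exact: inv.
have /choice[w Hw] : forall g, exists w, Delta w /\ forall e, e \in E -> w e = x (e * g)%g.
  by move=> g; have [w Dw /restrP wx] := xP g; exists w.
have /choice[v Hv] : forall g, exists v, Delta' v /\ R (w g) v.
  by move=> g; have [Dw _] := Hw g; have [v D'v wv] := tot _ Dw; exists v.
pose y g := v g 1%g.
have yv g d : (forall m, m \in M -> (m * d)%g \in E) -> y (d * g)%g = v g d.
  move=> MdE; apply: (RM _ _ _ _ 1%g d (Hv _).2 (Hv _).2) => m mM.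
  by rewrite mulg1 (Hw _).2 ?EM// (Hw _).2 ?MdE// mulgA.
have D'y : Delta' y.
  rewrite D'E => g; have := (Hv g).1; rewrite D'E => /(_ 1%g).
  congr P; apply/restrP => d dD; rewrite /shift mulg1 yv// => m mM.
  exact: ED.
have [z Dz zy] := tot' _ D'y; rewrite (_ : x = z)//; apply/funext => g.
have [_ /(_ _ E1)] := Hw g; rewrite mul1g => <-.
apply: (RN _ _ _ _ 1%g g (Hv g).2 zy) => n nN.
by rewrite mulg1 yv// => m mM; exact: EN.
Qed.

(** Points of Sigma agreeing with x on E n converge to x. *)
Lemma closed_prodiscreteP (A : choiceType) (Sigma : set (G -> A)) (E : nat -> {fset G}) x :
  closed_prodiscrete Sigma ->
  (forall g, exists n, forall m, (n <= m)%N -> g \in E m) ->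
  (forall n, (restr (E := E n) @` Sigma) (restr x)) -> Sigma x.
Proof.
move=> cS cofin xS.
have /choice[s Hs] : forall n, exists s, Sigma s /\ forall e, e \in E n -> s e = x e.
  by move=> n; have [s Ss /restrP sx] := xS n; exists s.
apply: (@closed_cvg _ {ptws G -> discrete_topology A} \oo _ s Sigma cS).
  by near=> n; have [] := Hs n.
apply/cvg_sup => g U.
have /= -> := @nbhsE (initial_topology
  (fun f : {ptws G -> discrete_topology A} => f g)) x.
move=> -[B [oB Bx] BU].
have [n0 Hn] := cofin g.
exists n0 => // n /= n0n; apply: BU; case: oB Bx => C _ <- /=.
by rewrite (Hs n).2// Hn.
Unshelve. all: end_near.
Qed.

End Conjugacy.

(** * Finite window of the inverse *)

(** The compactness argument: were there no window, the countable list C of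
    constructible conditions would be finitely satisfiable, and a solution
    decodes to two distinct configurations of Sigma with the same image. *)
Lemma tau_window (G : monoidType) (k : closedFieldType) (X Y : variety k)
    (Sigma : set (G -> X)) (tau : Sigma -> (G -> Y)) :
  countable [set: G] -> ~ countable [set: k] ->
  closed_prodiscrete Sigma -> is_algebraic_subshift Sigma ->
  is_algebraic_ca tau -> injective tau ->
  exists N : {fset G}, forall x y : Sigma,
  (forall n, n \in N -> tau x n = tau y n) -> set_val x 1%g = set_val y 1%g.
Proof.
move=> hG hk hclosed halg htau hinj; apply: contrapT => noN.
have sep (N : {fset G}) : exists xy : Sigma * Sigma,
    (forall n, n \in N -> tau xy.1 n = tau xy.2 n) /\
    set_val xy.1 1%g <> set_val xy.2 1%g.
  apply: contrapT => nxy; apply: noN; exists N => x y xyN.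
  by apply: contrapT => xy1; apply: nxy; exists (x, y).
have [V [enc [encI encC encR]]] := variety_coding X.
have [V' [enc' cod']] := variety_coding Y; have [enc'I _ _] := cod'.
have [M [mu [tauM muM]]] := htau.
have /countable_injP[f0 f0I] := hG.
have fI : injective f0 by move=> g h; apply: f0I; rewrite in_setE.
(* an enumeration of G, with e n an arbitrary element when n is not a rank *)
have /choice[e He] : forall n, exists g, forall h, f0 h = n -> g = h.
  move=> n; have [[g <-]|ng] := pselect (exists g, f0 g = n).
    by exists g => h /fI.
  by exists 1%g => h hn; exfalso; apply: ng; exists h.
pose E n : {fset G} := [fset e i | i in iota 0 n.+1]%fset.
have memE n i : (i <= n)%N -> e i \in E n.
  move=> i_n; have ii : i \in iota 0 n.+1 by rewrite mem_iota.
  exact: in_imfset.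
(* the variables: codes of x g, of y g and of the common value tau x g = tau y g *)
pose W := (G * (V + V + V'))%type.
have cW : countable [set: W].
  apply/countable_injP.
  exists (fun w : W => choice.pickle ((f0 w.1, w.2) : nat * (V + V + V'))).
  move=> -[g v] [h u] _ _ /=.
  by move=> /(pcan_inj choice.pickleK)[/fI-> ->].
pose xv (v : V) : V + V + V' := inl (inl v).
pose yv (v : V) : V + V + V' := inl (inr v).
pose SE (F : {fset G}) : set (prod_fspace F X) := restr (E := F) @` Sigma.
pose encE (F : {fset G}) (q : prod_fspace F X) (iv : F * V) := enc (q iv.1) iv.2.
have encEI F : injective (@encE F).
  move=> q r qr; apply/funext => i; apply: encI; apply/funext => v.
  exact: (congr1 (fun c => c (i, v)) qr).
have encEC F : charted (@encE F) by exact: charted_prod.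
pose inS (b : V -> V + V + V') n : set (W -> k) :=
  [set a | range (@encE (E n) \o set_val : sub_fspace (SE (E n)) -> _)
    (fun iv : E n * V => a (fsval iv.1, b iv.2))].
have cS b n : constructible (inS b n).
  apply: (constructible_reindex (fun iv : E n * V => (fsval iv.1, b iv.2))).
  by apply: charted_image; apply: charted_sub (encEC _); exact: halg.2.
pose gr (b : V -> V + V + V') g : set (W -> k) := [set a |
  exists s : restr (E := M) @` Sigma,
   encE M (set_val s) = (fun iv : M * V => a ((fsval iv.1 * g)%g, b iv.2)) /\
   enc' (mu s) = (fun t => a (g, inr t))].
have cgr b g : constructible (gr b g).
  have H := charted_morphism (charted_sub (halg.2 M) (encEC M))
    (inj_comp (encEI M) val_inj) cod' muM.
  apply: constructible_ext (constructible_reindex (fun o : M * V + V' => match o with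
    | inl iv => ((fsval iv.1 * g)%g, b iv.2) | inr t => (g, inr t) end) H).
  by move=> a.
pose neq1 : set (W -> k) := [set a | ~ forall v, a (1%g, xv v) = a (1%g, yv v)].
have cneq : constructible neq1.
  apply: constructibleC; apply: constructible_forall => v.
  by apply: constructible_eq; exact: polyfun_var.
pose C n := (inS xv n `&` inS yv n) `&` (gr xv (e n) `&` gr yv (e n)) `&` neq1.
have cC n : constructible (C n) by do ?apply: constructibleI.
(* the first m conditions are met by any x, y in Sigma with x 1 <> y 1 whose
   images agree on E m, with the codes of tau x as common value *)
have [|a Ca] := constructible_saturated hk cW cC.
  move=> m; have [[x y] /= [xyE xy1]] := sep (E m).
  pose a (w : W) : k := match w.2 with
    | inl (inl v) => enc (set_val x w.1) v
    | inl (inr v) => enc (set_val y w.1) v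
    | inr t => enc' (tau x w.1) t end.
  have ain n (s : Sigma) : range (@encE (E n) \o set_val :
      sub_fspace (SE (E n)) -> _) (fun iv => enc (set_val s (fsval iv.1)) iv.2).
    have sP : (restr (E := E n) @` Sigma) (restr (set_val s)).
      by exists (set_val s) => //; exact: set_valP.
    by exists (SigSub (mem_set sP)).
  have agr (s : Sigma) g : exists u : restr (E := M) @` Sigma,
      encE M (set_val u) = (fun iv => enc (set_val s (fsval iv.1 * g)%g) iv.2) /\
      enc' (mu u) = enc' (tau s g).
    by have [u uE ->] := tauM s g; exists u; rewrite uE.
  exists a => i im; split; [split; split|].
  - exact: ain.
  - exact: ain.
  - by have [u Hu] := agr x (e i); exists u.
  - have [u Hu] := agr y (e i); exists u; rewrite /a /= xyE//; exact: memE.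
  - by move=> xy; apply: xy1; apply: encI; apply/funext => v; exact: xy.
have eK g : e (f0 g) = g by exact: He.
have memEn g n : (f0 g <= n)%N -> g \in E n by move=> /memE; rewrite eK.
have decode b : (forall n, inS b n a) -> exists s : Sigma,
    forall g v, enc (set_val s g) v = a (g, b v).
  move=> bS.
  have /choice[x Hx] : forall g, exists p, forall v, enc p v = a (g, b v).
    move=> g; have [u _ uE] := bS (f0 g).
    exists (set_val u [` memEn g _ (leqnn _)]%fset) => v.
    exact: (congr1 (fun c => c ([` memEn g _ (leqnn _)]%fset, v)) uE).
  have Sx : Sigma x.
    apply: (closed_prodiscreteP (E := E) hclosed) => [g|n].
      by exists (f0 g); exact: memEn.
    have [u _ uE] := bS n; have := set_valP u; congr (_ _); apply: encEI.
    by rewrite [LHS]uE; apply/funext => iv; rewrite /encE Hx.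
  by exists (SigSub (mem_set Sx)).
have [n|x Hx] := decode xv; first by have [[[]]] := Ca n.
have [n|y Hy] := decode yv; first by have [[[]]] := Ca n.
have graph b (s : Sigma) : (forall g v, enc (set_val s g) v = a (g, b v)) ->
    (forall n, gr b (e n) a) -> forall g, enc' (tau s g) = (fun t => a (g, inr t)).
  move=> sb bgr g; have := bgr (f0 g); rewrite eK => -[u [uE <-]].
  have [u' u'E ->] := tauM s g; congr (enc' (mu _)); apply: val_inj; apply: encEI.
  apply: (etrans (congr1 (encE M) u'E)); rewrite [RHS]uE; apply/funext => iv.
  by rewrite -sb.
have xy : x = y.
  apply: hinj; apply/funext => g; apply: enc'I.
  rewrite (graph xv)//; last by move=> n; have [[_ []]] := Ca n.
  by rewrite (graph yv)// => n; have [[_ []]] := Ca n.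
have [_] := Ca 0%N; apply=> v; rewrite -Hx -Hy xy.
by [].
Qed.

Theorem theoremA (G : monoidType) (hG : countable [set: G])
  (k : closedFieldType) (hk : ~ countable [set: k])
  (X Y : variety k)
  (Sigma : set (G -> X))
  (hclosed : closed_prodiscrete Sigma)
  (halg : is_algebraic_subshift Sigma)
  (tau : Sigma -> (G -> Y))
  (htau : is_algebraic_ca tau)
  (hinj : injective tau)
  (Delta : set (G -> X))
  (hDelta : is_subshift Delta)
  (hsub : Delta `<=` Sigma) :
  (is_sft Delta <-> is_sft (image_in tau Delta)) /\
  (is_sofic Delta <-> is_sofic (image_in tau Delta)).
Proof.
pose R (x : G -> X) (y : G -> Y) := exists2 s : Sigma, set_val s = x & tau s = y.
have [M RM] : exists M, block_rel R M.
  by apply: ca_block; have [M [mu [tauM _]]] := htau; exists M, mu.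
have [N0 HN] := tau_window hG hk hclosed halg htau hinj.
have tau_shift (s : Sigma) g : exists2 s' : Sigma, set_val s' = shift g (set_val s) &
    tau s' = shift g (tau s).
  have Ss : Sigma (shift g (set_val s)) by apply: halg.1; exact: set_valP.
  exists (SigSub (mem_set Ss)) => //; apply/funext => h.
  apply: (RM _ _ _ _ h (h * g)%g); [by eexists|by exists s|] => m _.
  by rewrite mulgA.
have RN : block_rel (fun y x => R x y) N0.
  move=> _ _ _ _ g h [s <- <-] [s' <- <-] ss'.
  have [u uE tu] := tau_shift s g; have [u' u'E tu'] := tau_shift s' h.
  have := HN u u'; rewrite uE u'E tu tu' /shift !mul1g; apply; exact: ss'.
have tot x : Delta x -> exists2 y, image_in tau Delta y & R x y.
  move=> Dx; have Sx := hsub _ Dx; exists (tau (SigSub (mem_set Sx))).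
    by exists (SigSub (mem_set Sx)).
  by exists (SigSub (mem_set Sx)).
have tot' y : image_in tau Delta y -> exists2 x, Delta x & R x y.
  by move=> [s Ds <-]; exists (set_val s) => //; exists s.
have inv : is_subshift (image_in tau Delta).
  move=> g _ [s Ds <-]; have [s' s'E <-] := tau_shift s g; exists s' => //.
  by rewrite /= s'E; exact: hDelta.
have imE : image_in tau Delta = [set y | exists2 x, Delta x & R x y].
  apply/seteqP; split=> [y /tot'//|y [x Dx xy]].
  by have [y' Dy' /(block_rel_fun RM xy) ->] := tot _ Dx.
have preE : Delta = [set x | exists2 y, image_in tau Delta y & R x y].
  apply/seteqP; split=> [x /tot//|x [y Dy xy]].
  by have [x' Dx' x'y] := tot' _ Dy; rewrite (block_rel_fun RN xy x'y).
split; split.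
- exact: sft_preimage RN RM tot' tot inv.
- exact: sft_preimage RM RN tot tot' hDelta.
- move=> sD; rewrite imE; apply: sofic_image RM _ sD => x /tot[y _ xy].
  by exists y.
- move=> sD; rewrite preE; apply: sofic_image RN _ sD => y /tot'[x _ xy].
  by exists x.
Qed.
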